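(* Let $K$ be a field, $S=K[x_1,\ldots,x_n]$, and let $d\geq 1$ and $a_1,\ldots,a_n$ be nonnegative integers with $a_i\leq d$ for all $i$ and $\sum_{i=1}^n a_i\geq d$. Let $I=I_{d;a_1,\ldots,a_n}\subset S$ be the corresponding (non-zero) ideal of Veronese type. Then the following conditions are equivalent: (a) $I$ is a Cohen-Macaulay ideal; (b) $I$ is unmixed and equidimensional; (c) $I$ is unmixed.
   Context: The ideal of Veronese type $I_{d;a_1,\ldots,a_n}\subset S$ is the ideal generated by all monomials $x_1^{u_1}\cdots x_n^{u_n}$ with $u_1+\cdots+u_n=d$ and $0\leq u_i\leq a_i$ for all $i$. An ideal $J$ of $S$ is Cohen-Macaulay if $S/J$ is a Cohen-Macaulay ring. $J$ is unmixed if the associated prime ideals of $S/J$ are exactly the minimal prime ideals of $J$ (no condition on the heights is required). $J$ is equidimensional if $\dim(S/\mathfrak p)$ is the same number for all minimal primes $\mathfrak p$ of $J$. *)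

(* Defs.v *)
From HB Require Import structures.
From mathcomp Require Import all_boot all_order all_algebra.
From mathcomp Require Import generic_quotient ring_quotient.
From mathcomp Require Import boolp.
From mathcomp Require Import mpoly.
From mathcomp Require Import ring.

Set Implicit Arguments.
Unset Strict Implicit.
Unset Printing Implicit Defensive.

Import GRing.Theory.

Local Open Scope ring_scope.
Local Open Scope quotient_scope.

(* In ring_quotient, [idealr R] and [prime_idealr R] are boolean predicates
   and exclude the unit ideal.  Booleanity is no restriction here, since
   [boolp.asbool] (written [`[< Q >]]) turns any proposition into a boolean. *)

Section Ideals.
Variable R : comNzRingType.
Implicit Types (I M N : idealr R) (P Q : prime_idealr R) (s : seq R).

Definition ideal_gen (X : R -> Prop) : {pred R} :=
  fun f => `[< exists2 cs : seq (R * R),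
    (forall u, u \in cs -> X u.2) & f = \sum_(u <- cs) u.1 * u.2 >].

Definition ideal_seq s : {pred R} := ideal_gen (fun x => x \in s).

Definition noetherian : Prop :=
  forall I, exists s, I =i ideal_seq s.

Definition maximal_ideal M : Prop :=
  forall N, {subset M <= N} -> {subset N <= M}.

Definition minimal_prime I P : Prop :=
  {subset I <= P} /\
  forall Q, {subset I <= Q} -> {subset Q <= P} -> {subset P <= Q}.

(* [P] is the annihilator in [R] of an element of the [R]-module [R / I]. *)
Definition associated_prime I P : Prop :=
  exists z : {ideal_quot I},
    forall g : R, (g \in P) = (\pi_({ideal_quot I}) g * z == 0).

(* Chains P_0 < ... < P_k, of length k, in the spectrum of [R]. *)
Definition prime_chain (k : nat) : Prop :=
  exists P : 'I_k.+1 -> prime_idealr R,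
    forall i j : 'I_k.+1, (i < j)%N ->
      {subset P i <= P j} /\ ~ {subset P j <= P i}.

Definition has_krull_dim (k : nat) : Prop :=
  prime_chain k /\ forall l, prime_chain l -> (l <= k)%N.

Definition regular_seq s : Prop :=
  (forall i, (i < size s)%N ->
     forall y, s`_i * y \in ideal_seq (take i s) -> y \in ideal_seq (take i s))
  /\ 1 \notin ideal_seq s.

Definition has_depth M (k : nat) : Prop :=
  (exists s, [/\ regular_seq s, {subset s <= M} & size s = k]) /\
  forall s, regular_seq s -> {subset s <= M} -> (size s <= k)%N.

Definition unique_maximal_ideal M : Prop :=
  forall N, maximal_ideal N <-> N =i M.

Definition cohen_macaulay_local : Prop :=
  noetherian /\
  exists M, unique_maximal_ideal M /\
    exists2 k, has_depth M k & has_krull_dim k.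

End Ideals.

Arguments noetherian : clear implicits.
Arguments prime_chain : clear implicits.
Arguments has_krull_dim : clear implicits.
Arguments cohen_macaulay_local : clear implicits.

Section Localization.
Variables (R : comNzRingType) (P : prime_idealr R).

Definition fractions := {x : R * R | x.2 \notin P}.
HB.instance Definition _ := Choice.on fractions.
Implicit Types x y z : fractions.

(* The extra factor [u] is needed because [R] may have zero divisors. *)
Definition eq_frac x y : bool :=
  `[< exists2 u, u \notin P &
        u * ((sval x).1 * (sval y).2) = u * ((sval y).1 * (sval x).2) >].

Lemma notin_prime_mul u v : u \notin P -> v \notin P -> u * v \notin P.
Proof. by move=> uP vP; rewrite prime_idealrM negb_or uP. Qed.

Lemma notin_prime1 : 1 \notin P.
Proof. by rewrite idealr1. Qed.

Lemma eq_frac_is_equiv : equiv_class_of eq_frac.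
Proof.
split=> [x|x y|y x z].
- by apply/asboolP; exists 1 => //; apply: notin_prime1.
- by apply/asboolP/asboolP => -[u uP e]; exists u.
move=> /asboolP[u uP exy] /asboolP[v vP eyz]; apply/asboolP.
move: x y z exy eyz => [[a s] /= sP] [[b t] /= tP] [[c r] /= rP] exy eyz.
exists (u * v * t); first by rewrite !notin_prime_mul.
have -> : u * v * t * (a * r) = v * r * (u * (a * t)) by ring.
have -> : u * v * t * (c * s) = u * s * (v * (c * t)) by ring.
by rewrite exy -eyz; ring.
Qed.

Canonical eq_frac_equiv := EquivRelPack eq_frac_is_equiv.
Canonical eq_frac_encModRel := defaultEncModRel eq_frac.

Definition localization := {eq_quot eq_frac}.
HB.instance Definition _ : EqQuotient fractions eq_frac localization :=
  EqQuotient.on localization.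
HB.instance Definition _ := Choice.on localization.


Definition frac_of (a : R) s (sP : s \notin P) : fractions :=
  exist _ (a, s) sP.

Definition zerof := frac_of 0 notin_prime1.
Definition onef := frac_of 1 notin_prime1.
Definition oppf x := frac_of (- (sval x).1) (valP x).
Definition addf x y :=
  frac_of ((sval x).1 * (sval y).2 + (sval y).1 * (sval x).2)
          (notin_prime_mul (valP x) (valP y)).
Definition mulf x y :=
  frac_of ((sval x).1 * (sval y).1) (notin_prime_mul (valP x) (valP y)).

Lemma eq_fracP x y :
  reflect (exists2 u, u \notin P &
             u * ((sval x).1 * (sval y).2) = u * ((sval y).1 * (sval x).2))
          (x == y %[mod localization]).
Proof. by rewrite piE; apply: asboolP. Qed.

Definition zerol : localization := lift_cst localization zerof.
Definition onel : localization := lift_cst localization onef.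
Definition oppl := lift_op1 localization oppf.
Definition addl := lift_op2 localization addf.
Definition mull := lift_op2 localization mulf.

Canonical pi_zerol_morph := PiConst zerol.
Canonical pi_onel_morph := PiConst onel.

Lemma repr_pi_frac x :
  exists2 u, u \notin P &
    u * ((sval x).1 * (sval (repr (\pi_localization x))).2)
    = u * ((sval (repr (\pi_localization x))).1 * (sval x).2).
Proof. by apply/eq_fracP; rewrite reprK. Qed.

Lemma pi_oppl : {morph \pi_localization : x / oppf x >-> oppl x}.
Proof.
move=> x; unlock oppl; apply/eqP/eq_fracP => /=.
have [u uP e] := repr_pi_frac x; exists u => //.
by rewrite !mulNr !mulrN e.
Qed.
Canonical pi_oppl_morph := PiMorph1 pi_oppl.

Lemma pi_addl : {morph \pi_localization : x y / addf x y >-> addl x y}.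
Proof.
move=> x y; unlock addl; apply/eqP/eq_fracP => /=.
have [u uP ex] := repr_pi_frac x; have [v vP ey] := repr_pi_frac y.
move: ex ey; set x' := repr _; set y' := repr _.
move: (sval x) (sval x') (sval y) (sval y') => [a s] [a' s'] [b t] [b' t'] /= ex ey.
exists (u * v); first exact: notin_prime_mul.
have -> : u * v * ((a * t + b * s) * (s' * t'))
  = v * t * t' * (u * (a * s')) + u * s * s' * (v * (b * t')) by ring.
by rewrite ex ey; ring.
Qed.
Canonical pi_addl_morph := PiMorph2 pi_addl.

Lemma pi_mull : {morph \pi_localization : x y / mulf x y >-> mull x y}.
Proof.
move=> x y; unlock mull; apply/eqP/eq_fracP => /=.
have [u uP ex] := repr_pi_frac x; have [v vP ey] := repr_pi_frac y.
move: ex ey; set x' := repr _; set y' := repr _.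
move: (sval x) (sval x') (sval y) (sval y') => [a s] [a' s'] [b t] [b' t'] /= ex ey.
exists (u * v); first exact: notin_prime_mul.
have -> : u * v * (a * b * (s' * t')) = u * (a * s') * (v * (b * t')) by ring.
by rewrite ex ey; ring.
Qed.
Canonical pi_mull_morph := PiMorph2 pi_mull.

Lemma loc_ind (Q : localization -> Prop) :
  (forall x, Q (\pi_localization x)) -> forall l, Q l.
Proof. by move=> Qpi l; rewrite -[l]reprK; apply: Qpi. Qed.

Lemma eq_pi_frac x y :
  (sval x).1 * (sval y).2 = (sval y).1 * (sval x).2 ->
  \pi_localization x = \pi_localization y.
Proof.
by move=> e; apply/eqP/eq_fracP; exists 1; rewrite ?notin_prime1 ?e.
Qed.

Lemma addlA : associative addl.
Proof.
elim/loc_ind=> x; elim/loc_ind=> y; elim/loc_ind=> z.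
by rewrite -!pi_addl; apply: eq_pi_frac => /=; ring.
Qed.

Lemma addlC : commutative addl.
Proof.
elim/loc_ind=> x; elim/loc_ind=> y.
by rewrite -!pi_addl; apply: eq_pi_frac => /=; ring.
Qed.

Lemma add0l : left_id zerol addl.
Proof.
elim/loc_ind=> x; unlock zerol.
by rewrite -pi_addl; apply: eq_pi_frac => /=; ring.
Qed.

Lemma addNl : left_inverse zerol oppl addl.
Proof.
elim/loc_ind=> x; unlock zerol.
by rewrite -pi_oppl -pi_addl; apply: eq_pi_frac => /=; ring.
Qed.

HB.instance Definition _ :=
  GRing.isZmodule.Build localization addlA addlC add0l addNl.

Lemma mullA : associative mull.
Proof.
elim/loc_ind=> x; elim/loc_ind=> y; elim/loc_ind=> z.
by rewrite -!pi_mull; apply: eq_pi_frac => /=; ring.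
Qed.

Lemma mullC : commutative mull.
Proof.
elim/loc_ind=> x; elim/loc_ind=> y.
by rewrite -!pi_mull; apply: eq_pi_frac => /=; ring.
Qed.

Lemma mul1l : left_id onel mull.
Proof.
elim/loc_ind=> x; unlock onel.
by rewrite -pi_mull; apply: eq_pi_frac => /=; ring.
Qed.

Lemma mullDl : left_distributive mull +%R.
Proof.
elim/loc_ind=> x; elim/loc_ind=> y; elim/loc_ind=> z.
rewrite -[_ + _]pi_addl -!pi_mull -[_ + _]pi_addl.
by apply: eq_pi_frac => /=; ring.
Qed.

Lemma onel_neq0 : onel != 0.
Proof.
have -> : (0 : localization) = zerol by [].
unlock onel zerol; apply/eq_fracP => -[u uP] /=.
by rewrite !mulr1 mulr0 => u0; move: uP; rewrite u0 idealr0.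
Qed.

HB.instance Definition _ := GRing.Zmodule_isComNzRing.Build localization
  mullA mullC mul1l mullDl onel_neq0.

End Localization.

Definition cohen_macaulay (R : comNzRingType) : Prop :=
  noetherian R /\
  forall P : prime_idealr R, maximal_ideal P ->
    cohen_macaulay_local (localization P).

Section IdealProperties.
Variables (R : comNzRingType) (J : idealr R).

Definition cohen_macaulay_ideal : Prop := cohen_macaulay {ideal_quot J}.

Definition unmixed : Prop :=
  forall P : prime_idealr R, associated_prime J P <-> minimal_prime J P.

Definition equidimensional : Prop :=
  exists k, forall P : prime_idealr R,
    minimal_prime J P -> has_krull_dim {ideal_quot P} k.

End IdealProperties.

Section Veronese.
Variables (K : fieldType) (n d : nat) (a : 'I_n -> nat).

Definition veronese_gens (f : {mpoly K[n]}) : Prop :=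
  exists u : 'X_{1..n}, [/\ mdeg u = d, forall i, (u i <= a i)%N & f = 'X_[u]].

Definition veronese : {pred {mpoly K[n]}} := ideal_gen veronese_gens.

Lemma veronese_idealr_closed : (0 < d)%N -> idealr_closed veronese.
Proof.
move=> d_gt0; split.
- by apply/asboolP; exists [::]; rewrite ?big_nil.
- apply/asboolP => -[cs gen_cs] /(congr1 (fun f => f@_0%MM)).
  rewrite mcoeff1 eqxx raddf_sum /= big_seq big1 => [/eqP|c /gen_cs].
    by rewrite oner_eq0.
  case=> u [du _ ->]; rewrite rmorphM /= mcoeffX.
  case: eqP => [u0|_]; last by rewrite mulr0.
  by move: d_gt0; rewrite -du u0 mdeg0.
move=> c f g /asboolP[cs gen_cs ->] /asboolP[cs' gen_cs' ->]; apply/asboolP.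
exists ([seq (c * u.1, u.2) | u <- cs] ++ cs').
  by move=> u; rewrite mem_cat => /orP[/mapP[v /gen_cs ? ->]|/gen_cs'].
rewrite big_cat big_map mulr_sumr; congr (_ + _).
by apply: eq_bigr => u _; rewrite mulrA.
Qed.

Definition veronese_ideal (d_gt0 : (0 < d)%N) : idealr {mpoly K[n]} :=
  HB.pack veronese (isIdealr.Build _ veronese (veronese_idealr_closed d_gt0)).

End Veronese.

(* Main.v *)
(** The associated primes of [S / I] include the monomial primes
[P_A = (x_i : i in A)] with [A] in the support of [a] and
[#|A| <= mu <= sum_(i in A) a_i], where [mu = sum_i a_i - d + 1]; a prime
contains [I] iff the variables in it have [a]-weight at least [mu].  If [I] is
unmixed, all such [A] have the same size [c], since enlarging a smaller one by
an element of a larger one would give an embedded prime.  Hence [I] is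
equidimensional.  The condition that all such [A] have size [c] passes to
[I : x_i] and [I + (x_i)], so [S / I] is filtered by modules [S / P_A] with
[#|A| = c].  Given a maximal ideal [M], Zariski's lemma provides monic
[z_i = g_i(x_i)] in [M], divisible by [x_i]; the elementary symmetric functions
[e_(n-c)(z), ..., e_1(z)] then form a regular sequence on every such
[S / P_A], hence on [S / I], and [S / I] has depth [n - c] at [M].  The bound
[n - c] on the dimension comes from the algebraic dependence of [r + 1]
polynomials in [r] variables.  Conversely, over a Cohen-Macaulay ring a regular
sequence of length [k] produces a chain of [k + 1] primes starting at any
given associated prime, which is therefore minimal. *)

From HB Require Import structures.
From mathcomp Require Import all_boot all_order all_algebra.
From mathcomp Require Import mxpoly generic_quotient ring_quotient.
From mathcomp Require Import boolp.
From mathcomp Require Import mpoly ring.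
Require Import Defs.

Set Implicit Arguments.
Unset Strict Implicit.
Unset Printing Implicit Defensive.

Import GRing.Theory.

Local Open Scope ring_scope.
Local Open Scope quotient_scope.

(** * Ideals as predicates *)

(** Depth has to be found at every maximal ideal, over a field that need not be algebraically
    closed, and one sequence must serve all the quotients S / P_A at once. Since z_i is a multiple
    of x_i, it vanishes modulo P_A for i in A, so e_(n-c)(z) reduces to the single product of the
    z_i outside A; its factors are monic in separate variables, hence non-zero-divisors. The
    decreasing order makes this recur: a killed factor acts like one more variable in A. Colons and
    sums in the filtration may be the unit ideal. Ideals are therefore predicates that may be
    improper, and regularity drops the condition on 1, which is checked only in the local ring. No
    homological algebra is used: a regular sequence in a local ring yields a chain of primes of the
    same length, so an upper bound on chains bounds the depth, and a regular sequence of that length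
    makes depth and dimension agree. *)

Section PropIdeals.
Variable R : comNzRingType.
Implicit Types (I J P Q : R -> Prop) (s : seq R) (x y z : R).

Record is_ideal J : Prop := IsIdeal {
  ideal0 : J 0;
  idealD : forall x y, J x -> J y -> J (x + y);
  idealM : forall r x, J x -> J (r * x) }.

Record is_prime P : Prop := IsPrime {
  prime_ideal : is_ideal P;
  prime1 : ~ P 1;
  primeM : forall x y, P (x * y) -> P x \/ P y }.

Definition subideal I J := forall x, I x -> J x.
Definition zero_ideal := fun x => x = 0.
Definition adjoin J x := fun y => exists r, J (y - r * x).
Definition colon J x := fun y => J (y * x).
Definition adjoins := foldl adjoin.

Lemma eq_ideal I J : (forall x, I x <-> J x) -> I = J.
Proof. by move=> e; apply/funext => x; apply/propext. Qed.

Lemma idealN J x : is_ideal J -> J x -> J (- x).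
Proof. by move=> iJ Jx; rewrite -mulN1r; apply: idealM. Qed.

Lemma idealB J x y : is_ideal J -> J x -> J y -> J (x - y).
Proof. by move=> iJ Jx Jy; apply: idealD => //; apply: idealN. Qed.

Lemma ideal_mulr J r x : is_ideal J -> J x -> J (x * r).
Proof. by rewrite mulrC => iJ; apply: idealM. Qed.

Lemma ideal_sub_eq J x y : is_ideal J -> J (x - y) -> J y -> J x.
Proof. by move=> iJ h1 h2; rewrite -(subrK y x); apply: idealD. Qed.

Lemma ideal_sum J (T : Type) (r : seq T) (p : pred T) (F : T -> R) :
  is_ideal J -> (forall i, p i -> J (F i)) -> J (\sum_(i <- r | p i) F i).
Proof. by move=> iJ JF; elim/big_ind: _ => //; case: iJ. Qed.

Lemma zero_is_ideal : is_ideal zero_ideal.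
Proof.
by split=> // [x y -> ->|r x ->]; rewrite /zero_ideal ?addr0 ?mulr0.
Qed.

Lemma adjoin_ideal J x : is_ideal J -> is_ideal (adjoin J x).
Proof.
move=> iJ; split.
- by exists 0; rewrite mul0r subr0; case: iJ.
- move=> y z [r Jr] [t Jt]; exists (r + t).
  by rewrite (_ : _ - _ = (y - r * x) + (z - t * x)); [apply: idealD|ring].
- move=> t y [r Jr]; exists (t * r).
  by rewrite (_ : _ - _ = t * (y - r * x)); [apply: idealM|ring].
Qed.

Lemma colon_ideal J x : is_ideal J -> is_ideal (colon J x).
Proof.
move=> iJ; split; rewrite /colon.
- by rewrite mul0r; case: iJ.
- by move=> y z; rewrite mulrDl; apply: idealD.
- by move=> r y; rewrite -mulrA; apply: idealM.
Qed.

Lemma sub_adjoin J x : is_ideal J -> subideal J (adjoin J x).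
Proof. by move=> iJ y Jy; exists 0; rewrite mul0r subr0. Qed.

Lemma mem_adjoin J x : is_ideal J -> adjoin J x x.
Proof. by move=> iJ; exists 1; rewrite mul1r subrr; case: iJ. Qed.

Lemma adjoin_min I J x : is_ideal I -> subideal J I -> I x ->
  subideal (adjoin J x) I.
Proof.
move=> iI JI Ix y [r /JI h].
exact: (ideal_sub_eq iI h (idealM iI _ Ix)).
Qed.

Lemma adjoinC J x y : adjoin (adjoin J x) y = adjoin (adjoin J y) x.
Proof.
by apply: eq_ideal => z; split=> -[r [t h]]; exists t, r;
  rewrite addrAC.
Qed.

Lemma adjoins_ideal J s : is_ideal J -> is_ideal (adjoins J s).
Proof. by elim: s J => //= x s IH J iJ; apply/IH/adjoin_ideal. Qed.

Lemma sub_adjoins J s : is_ideal J -> subideal J (adjoins J s).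
Proof.
elim: s J => [|x s IH] J iJ y Jy //=; apply: IH; first exact: adjoin_ideal.
exact: sub_adjoin.
Qed.

Lemma mem_adjoins J s x : is_ideal J -> x \in s -> adjoins J s x.
Proof.
elim: s J => //= y s IH J iJ; rewrite inE => /predU1P[->|xs].
  by apply: sub_adjoins; [apply: adjoin_ideal|apply: mem_adjoin].
by apply: IH => //; apply: adjoin_ideal.
Qed.

Lemma adjoins_min I J s : is_ideal I -> subideal J I ->
  (forall x, x \in s -> I x) -> subideal (adjoins J s) I.
Proof.
elim: s J => //= x s IH J iI JI sI; apply: IH => //.
  by apply: adjoin_min => //; apply: sI; rewrite mem_head.
by move=> y ys; apply: sI; rewrite inE ys orbT.
Qed.

Definition span s := adjoins zero_ideal s.

Lemma span_ideal s : is_ideal (span s).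
Proof. exact/adjoins_ideal/zero_is_ideal. Qed.

Lemma mem_span s x : x \in s -> span s x.
Proof. exact/mem_adjoins/zero_is_ideal. Qed.

Lemma span_min I s : is_ideal I -> (forall x, x \in s -> I x) ->
  subideal (span s) I.
Proof. by move=> iI; apply: adjoins_min => // x ->; case: iI. Qed.

(** The universal property of the generated ideal: membership proofs go by minimality instead of
    through lists of coefficients. *)
Lemma ideal_genP (X : R -> Prop) f :
  f \in ideal_gen X <->
  (forall I, is_ideal I -> (forall x, X x -> I x) -> I f).
Proof.
rewrite /ideal_gen; split.
  move=> /asboolP[cs csX ->] I iI XI; rewrite big_seq.
  by apply: ideal_sum => // u /csX/XI; apply: idealM.
pose G x := `[< exists2 cs : seq (R * R),
    (forall u, u \in cs -> X u.2) & x = \sum_(u <- cs) u.1 * u.2 >].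
move=> /(_ G); apply=> [|x Xx]; rewrite /G.
  split=> [|x y|r x].
  - by apply/asboolP; exists [::]; rewrite ?big_nil.
  - move=> /asboolP[c1 h1 ->] /asboolP[c2 h2 ->]; apply/asboolP.
    exists (c1 ++ c2); last by rewrite big_cat.
    by move=> u; rewrite mem_cat => /orP[/h1|/h2].
  - move=> /asboolP[c1 h1 ->]; apply/asboolP.
    exists [seq (r * u.1, u.2) | u <- c1].
      by move=> u /mapP[v /h1 ? ->].
    by rewrite big_map mulr_sumr; apply: eq_bigr => u _; rewrite mulrA.
apply/asboolP; exists [:: (1, x)]; last by rewrite big_seq1 mul1r.
by move=> u; rewrite inE => /eqP ->.
Qed.

Lemma ideal_seqP s x : x \in ideal_seq s <-> span s x.
Proof.
split; first by move/ideal_genP; apply; [apply: span_ideal|apply: mem_span].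
by move=> h; apply/ideal_genP => I iI sI; apply: (span_min iI sI).
Qed.

Lemma idealr_is_ideal (J : idealr R) : is_ideal (fun x => x \in J).
Proof.
split; [exact: rpred0|by move=> x y; apply: rpredD|].
by move=> r x xJ; apply: idealMr.
Qed.

Lemma idealr_proper (J : idealr R) : ~ 1 \in J.
Proof. by rewrite idealr1. Qed.

Lemma prime_idealr_is_prime (P : prime_idealr R) : is_prime (fun x => x \in P).
Proof.
split; [exact: idealr_is_ideal|exact: idealr_proper|].
by move=> x y; rewrite prime_idealrM => /orP.
Qed.

Lemma exists_idealr J : is_ideal J -> ~ J 1 ->
  exists M : idealr R, forall x, x \in M <-> J x.
Proof.
move=> iJ J1; pose S : {pred R} := fun x => `[< J x >].
have cS : idealr_closed S.
  split; [by apply/asboolP; case: iJ|by apply/asboolP|].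
  move=> a x y /asboolP Jx /asboolP Jy; apply/asboolP.
  by apply: idealD => //; apply: idealM.
exists (HB.pack_for (idealr R) S (isIdealr.Build _ S cS)) => x.
by split=> /asboolP.
Qed.

Lemma exists_prime_idealr P : is_prime P ->
  exists M : prime_idealr R, forall x, x \in M <-> P x.
Proof.
case=> iP P1 PM; pose S : {pred R} := fun x => `[< P x >].
have cS : idealr_closed S.
  split; [by apply/asboolP; case: iP|by apply/asboolP|].
  move=> a x y /asboolP Jx /asboolP Jy; apply/asboolP.
  by apply: idealD => //; apply: idealM.
have pS : prime_idealr_closed S.
  by move=> x y /asboolP/PM[]?; apply/orP; [left|right]; apply/asboolP.
exists (HB.pack_for (prime_idealr R) S (isIdealr.Build _ S cS)
          (isPrimeIdealrClosed.Build _ S pS)) => x.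
by split=> /asboolP.
Qed.

(** * Noetherian rings *)

Definition fin_gen J := exists s, J = span s.
Definition noeth := forall J, is_ideal J -> fin_gen J.

(** [noetherian] speaks of proper ideals only, [noeth] of all; the unit ideal is generated by 1. *)
Lemma noetherianP : noetherian R <-> noeth.
Proof.
split=> [nR J iJ|nR J].
  have [J1|J1] := pselect (J 1).
    exists [:: 1]; apply: eq_ideal => x; split=> _.
      rewrite -[x]mulr1; apply: idealM; first exact: span_ideal.
      by apply: mem_span; rewrite mem_head.
    by rewrite -[x]mulr1; apply: idealM.
  have [M eM] := exists_idealr iJ J1; have [s es] := nR M.
  by exists s; apply: eq_ideal => x; rewrite -eM es ideal_seqP.
have [s es] := nR _ (idealr_is_ideal J); exists s => x.
by apply/idP/idP; rewrite ideal_seqP -es.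
Qed.

(** Without a maximal member above [J0], choice gives a map [f] that strictly enlarges every member
    of [F] above [J0]. The union of its iterates is finitely generated, so it is reached at a finite
    stage, and the next stage contradicts strictness. *)
Lemma noeth_maximal (F : (R -> Prop) -> Prop) J0 : noeth ->
  (forall J, F J -> is_ideal J) -> F J0 ->
  exists J, [/\ F J, subideal J0 J & forall J', F J' -> subideal J J' -> J' = J].
Proof.
move=> nR Fi FJ0; apply: contrapT => noJ.
have next J : F J /\ subideal J0 J ->
    exists J', (F J' /\ subideal J0 J') /\ (subideal J J' /\ ~ subideal J' J).
  move=> [FJ sJ]; apply: contrapT => h; apply: noJ; exists J; split=> //.
  move=> J' FJ' sJJ'; apply: contrapT => ne; apply: h; exists J'.
  split; first by split=> // x /sJ/sJJ'.
  by split=> // sJ'J; apply: ne; apply: eq_ideal => x; split; [apply: sJ'J|apply: sJJ'].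
have [f fP] : {f : (R -> Prop) -> (R -> Prop) & forall J, F J /\ subideal J0 J ->
    (F (f J) /\ subideal J0 (f J)) /\ (subideal J (f J) /\ ~ subideal (f J) J)}.
  apply: (@choice _ _ (fun J J' => F J /\ subideal J0 J ->
    (F J' /\ subideal J0 J') /\ (subideal J J' /\ ~ subideal J' J))) => J.
  have [h|h] := pselect (F J /\ subideal J0 J); last by exists J.
  by have [J' ?] := next J h; exists J'.
pose C k := iter k f J0.
have CP k : F (C k) /\ subideal J0 (C k).
  by elim: k => [|k IH]; [split|rewrite /C iterS; apply (fP _ IH)].
have Cmono k l : (k <= l)%N -> subideal (C k) (C l).
  move=> /subnK <-; elim: (l - k)%N => // j IH x /IH.
  by rewrite addSn /C iterS; apply (fP _ (CP _)).
pose U x := exists k, C k x.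
have iU : is_ideal U.
  split.
  - by exists 0%N; case: (Fi _ FJ0).
  - move=> x y [k Ck] [l Cl]; exists (maxn k l); apply: idealD; first exact: Fi (CP _).1.
      exact: Cmono (leq_maxl _ _) _ Ck.
    exact: Cmono (leq_maxr _ _) _ Cl.
  - by move=> r x [k Ck]; exists k; apply: idealM => //; apply: Fi (CP _).1.
have [s es] := nR U iU.
have [N sN] : exists N, forall x, x \in s -> C N x.
  have: forall x, x \in s -> U x by move=> x xs; rewrite es; apply: mem_span.
  elim: s {es} => [|x s IH] h; first by exists 0%N.
  have [k Ck] := h x (mem_head _ _).
  have [|l Cl] := IH; first by move=> y ys; apply: h; rewrite inE ys orbT.
  exists (maxn k l) => y; rewrite inE => /predU1P[->|/Cl].
    exact: Cmono (leq_maxl _ _) _ Ck.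
  exact: Cmono (leq_maxr _ _) _.
apply: (fP _ (CP N)).2.2 => x Cx.
have: U x by exists N.+1.
by rewrite es; apply: span_min => //; apply: Fi (CP _).1.
Qed.

Lemma exists_maximal J0 : noeth -> is_ideal J0 -> ~ J0 1 ->
  exists M : prime_idealr R, maximal_ideal M /\ forall x, J0 x -> x \in M.
Proof.
move=> nR iJ0 J01.
have [|J [[iJ J1] sJ Jmax]] :=
    @noeth_maximal (fun J => is_ideal J /\ ~ J 1) J0 nR _ (conj iJ0 J01).
  by move=> ? [].
have pJ : is_prime J.
  split=> // x y Jxy.
  have [Jx|nJx] := pselect (J x); [by left|right].
  have [r Jr] : adjoin J x 1.
    apply: contrapT => n1; apply: nJx.
    rewrite -(Jmax (adjoin J x)); first exact: mem_adjoin.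
      by split=> //; apply: adjoin_ideal.
    exact: sub_adjoin.
  rewrite (_ : y = (1 - r * x) * y + r * (x * y)); last by ring.
  by apply: idealD => //; [apply: ideal_mulr|apply: idealM].
have [M eM] := exists_prime_idealr pJ; exists M; split=> [N sMN x xN|x /sJ]; last by rewrite eM.
rewrite eM -(Jmax (fun x => x \in N)) //.
  by split; [apply: idealr_is_ideal|apply: idealr_proper].
by move=> y Jy; apply: sMN; rewrite eM.
Qed.

(** * Weakly regular sequences *)

Definition nzd J x := forall y, J (x * y) -> J y.

(** Regularity on R / J without properness of the final quotient, so that the pieces of a filtration
    may be zero. The recursion changes the ideal and keeps the ring. *)
Fixpoint wreg J s : Prop :=
  if s is x :: s' then nzd J x /\ wreg (adjoin J x) s' else True.

Lemma wregP J s : wreg J s <->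
  forall i, (i < size s)%N -> nzd (adjoins J (take i s)) s`_i.
Proof.
elim: s J => [|x s IH] J /=; first by split.
rewrite IH; split=> [[h1 h2] [|i] //=|h]; first exact: h2.
by split=> [|i i_s]; [exact: (h 0%N)|exact: (h i.+1)].
Qed.

Lemma regular_seqP s : regular_seq s <-> wreg zero_ideal s /\ ~ span s 1.
Proof.
rewrite wregP /regular_seq /nzd; split=> -[h1 h2]; split.
- by move=> i i_s y /ideal_seqP h; apply/ideal_seqP; apply: h1.
- by move/ideal_seqP => h; rewrite h in h2.
- by move=> i i_s y /ideal_seqP h; apply/ideal_seqP; apply: h1.
- by apply/negP => /ideal_seqP.
Qed.

(** As x is regular on R / (J + f), the exact sequence 0 -> R/(J : f) -> R/J -> R/(J + f) -> 0 stays
    exact modulo x; this identifies its new first term. *)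
Lemma colon_adjoin J x f : is_ideal J -> nzd (adjoin J f) x ->
  colon (adjoin J x) f = adjoin (colon J f) x.
Proof.
move=> iJ hx; apply: eq_ideal => y; rewrite /colon; split; last first.
  move=> [r]; rewrite mulrBl => h; exists (r * f).
  by rewrite mulrAC.
move=> [t Jt].
have [r Jr] : adjoin J f t.
  apply: hx; exists y.
  by rewrite -opprB [x * t]mulrC; apply: idealN.
exists r.
rewrite (_ : _ * f = (y * f - t * x) + (t - r * f) * x); last by ring.
by apply: idealD => //; apply: ideal_mulr.
Qed.

(* The exact sequence 0 -> R/(J : f) -> R/J -> R/(J + f) -> 0. *)
Lemma wreg_ext J f s : is_ideal J ->
  wreg (colon J f) s -> wreg (adjoin J f) s -> wreg J s.
Proof.
elim: s J => //= x s IH J iJ [h1 h2] [h3 h4]; split.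
  move=> y Jxy; have [r Jr] : adjoin J f y by apply: h3; apply: sub_adjoin.
  apply: (ideal_sub_eq iJ Jr); apply: h1; rewrite /colon -mulrA.
  rewrite (_ : x * _ = x * y - x * (y - r * f)); last by ring.
  by apply: idealB => //; apply: idealM.
apply: IH; first exact: adjoin_ideal.
  by rewrite colon_adjoin.
by rewrite adjoinC.
Qed.

Lemma wreg_unit J s : is_ideal J -> J 1 -> wreg J s.
Proof.
elim: s J => //= x s IH J iJ J1; split=> [y _|].
  by rewrite -[y]mulr1; apply: idealM.
by apply: IH; [apply: adjoin_ideal|apply: sub_adjoin].
Qed.

(** * Chains of primes *)

Definition strict_sub I J := subideal I J /\ ~ subideal J I.

Definition chain (l : nat) (P : nat -> R -> Prop) :=
  (forall i, (i <= l)%N -> is_prime (P i)) /\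
  (forall i, (i < l)%N -> strict_sub (P i) (P i.+1)).

Lemma chain_sub l (P : nat -> R -> Prop) i j :
  chain l P -> (i <= j <= l)%N -> subideal (P i) (P j).
Proof.
move=> [_ h] /andP[/subnK <-]; elim: (j - i)%N => [|k IH] kl x Px //.
by apply: (proj1 (h _ kl)); apply: IH => //; apply: ltnW.
Qed.

Lemma prime_chainP l : prime_chain R l <-> exists P : nat -> R -> Prop, chain l P.
Proof.
split=> [[P hP]|[P hP]].
  exists (fun i x => x \in P (inord i)); split=> i i_l; first exact: prime_idealr_is_prime.
  have [|h1 h2] := hP (inord i) (inord i.+1).
    by rewrite !inordK // ltnS // ltnW.
  by split=> // x; apply: h1.
have [p p1] := hP.
have /choice[Q hQ] : forall i : 'I_l.+1, exists M : prime_idealr R, forall x, x \in M <-> P i x.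
  by move=> i; apply: exists_prime_idealr; apply: p; rewrite -ltnS.
exists Q => i j ij; split.
  move=> x /hQ Px; apply/hQ; apply: (chain_sub hP) Px.
  by rewrite (ltnW ij) -ltnS ltn_ord.
move=> h; have il : (i < l)%N by apply: leq_trans ij _; rewrite -ltnS.
apply: (p1 i il).2 => x Px; apply/hQ/h/hQ.
by apply: (chain_sub hP) Px; rewrite ij -ltnS ltn_ord.
Qed.

Definition cons_chain (Q : R -> Prop) (P : nat -> R -> Prop) i :=
  if i is j.+1 then P j else Q.

Lemma cons_chainP l Q (P : nat -> R -> Prop) :
  chain l P -> is_prime Q -> strict_sub Q (P 0%N) -> chain l.+1 (cons_chain Q P).
Proof. by move=> [h1 h2] pQ sQ; split=> -[|i] //=; [apply: h1|apply: h2]. Qed.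

(** * Associated primes *)

Definition associated J P := is_prime P /\ exists z, P = colon J z.

(** An annihilator I = J : w, maximal among those of elements w of [N] outside J, is prime: if x y
    is in I and y w is not in J, then J : (y w) contains I, hence equals it, and it contains x. *)
Lemma exists_associated J (N : R -> Prop) : noeth -> is_ideal J ->
  (forall r w, N w -> N (r * w)) -> (exists2 w, N w & ~ J w) ->
  exists z, N z /\ associated J (colon J z).
Proof.
move=> nR iJ NM [w0 Nw0 Jw0].
pose F I := exists2 w, N w & ~ J w /\ I = colon J w.
have [||I [[w Nw [Jw eI]] _ Imax]] := @noeth_maximal F (colon J w0) nR.
- by move=> I [w _ [_ ->]]; apply: colon_ideal.
- by exists w0.
exists w; split=> //; split; last by exists w.
split; first exact: colon_ideal.
  by rewrite /colon mul1r.
move=> x y; rewrite /colon -mulrA => Jxyw.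
have [Jyw|nJyw] := pselect (J (y * w)); [by right|left].
have e : colon J (y * w) = I.
  apply: Imax; first by exists (y * w) => //; apply: NM.
  by move=> t; rewrite eI /colon mulrCA; apply: idealM.
by have : I x; [rewrite -e|rewrite eI].
Qed.

(** Membership in the Jacobson radical, in the form used by Nakayama arguments. *)
Definition jac x := forall r, exists u, u * (1 - r * x) = 1.

(** If P w lies in J, the annihilator of w modulo J + (x) contains P, and also x, which is not in P.
    The point is to find such a w outside J + (x). *)
Lemma associated_step J P x : noeth -> is_ideal J -> associated J P -> jac x -> nzd J x ->
  exists Q, associated (adjoin J x) Q /\ strict_sub P Q.
Proof.
move=> nR iJ [pP [z0 eP]] jx hx.
pose N w := forall p, P p -> J (p * w).
have NM r w : N w -> N (r * w).
  by move=> h p /h; rewrite mulrCA; apply: idealM.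
have Jz0 : ~ J z0 by move=> h; apply: (prime1 pP); rewrite eP /colon mul1r.
(* A Nakayama argument. If [N] lies in J + (x), take y in [N] outside J with J + (y) maximal. Then y
   = t x modulo J, and t is again in [N] because x is regular; so J + (t) = J + (y) and t = r x t
   modulo J, where 1 - r x is a unit. *)
have [w Nw Jw] : exists2 w, N w & ~ adjoin J x w.
  apply: contrapT => h.
  have sN w : N w -> adjoin J x w.
    by move=> Nw; apply: contrapT => ?; apply: h; exists w.
  pose F I := exists2 y, N y & ~ J y /\ I = adjoin J y.
  have [||I [[y Ny [Jy eI]] _ Imax]] := @noeth_maximal F (adjoin J z0) nR.
  - by move=> I [w _ [_ ->]]; apply: adjoin_ideal.
  - by exists z0 => // p; rewrite eP.
  have [t Jt] := sN y Ny.
  have Nt : N t.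
    move=> p Pp; apply: hx.
    rewrite (_ : _ * _ = p * y - p * (y - t * x)); last by ring.
    by apply: idealB => //; [apply: Ny|apply: idealM].
  have nJt : ~ J t.
    by move=> h'; apply: Jy; apply: (ideal_sub_eq iJ Jt); apply: ideal_mulr.
  have : I t.
    rewrite -(Imax (adjoin J t)); [exact: mem_adjoin|by exists t|].
    rewrite eI; apply: adjoin_min; first exact: adjoin_ideal.
      exact: sub_adjoin.
    by exists x; rewrite mulrC.
  rewrite eI => -[r Jr]; have [u eu] := jx r.
  apply: nJt; rewrite -[t]mul1r -eu.
  rewrite (_ : _ * t = u * ((t - r * y) + r * (y - t * x))); last by ring.
  by apply: (idealM iJ); apply: (idealD iJ) => //; apply: (idealM iJ).
have iJx : is_ideal (adjoin J x) by apply: adjoin_ideal.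
have [z [Nz aQ]] := exists_associated nR iJx NM (ex_intro2 _ _ w Nw Jw).
exists (colon (adjoin J x) z); split=> //; split.
  by move=> p Pp; apply: sub_adjoin => //; apply: Nz.
move=> /(_ x) h; have : P x.
  by apply: h; rewrite /colon mulrC; apply: idealM => //; apply: mem_adjoin.
by rewrite eP => /hx.
Qed.

Lemma wreg_chain J P s : noeth -> is_ideal J -> associated J P ->
  (forall x, x \in s -> jac x) -> wreg J s ->
  exists2 C, chain (size s) C & C 0%N = P.
Proof.
move=> nR; elim: s J P => [|x s IH] J P iJ aP js /=.
  by exists (fun _ => P) => //; split=> // i _; apply: aP.1.
move=> [hx hs]; have [Q [aQ sPQ]] := associated_step nR iJ aP (js x (mem_head _ _)) hx.
have [|C hC C0] := IH _ _ (adjoin_ideal _ iJ) aQ _ hs.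
  by move=> y ys; apply: js; rewrite inE ys orbT.
by exists (cons_chain P C) => //; apply: cons_chainP => //; [apply: aP.1|rewrite C0].
Qed.

End PropIdeals.

(** * Quotients and localizations *)

(* [phi] identifies [R] with the ring of fractions of [S / I] with
   denominators in [V]. *)
Record is_frac (S R : comNzRingType) (phi : {rmorphism S -> R})
    (V I : S -> Prop) : Prop := IsFrac {
  frac_ideal : is_ideal I;
  frac1 : V 1;
  fracM : forall v w, V v -> V w -> V (v * w);
  frac_repr : forall r, exists2 v, V v & exists g, phi v * r = phi g;
  frac_unit : forall v, V v -> exists u, u * phi v = 1;
  frac_ker : forall g, phi g = 0 <-> exists2 v, V v & I (v * g) }.

Section FractionMap.
Variables (S R : comNzRingType) (phi : {rmorphism S -> R}) (V I : S -> Prop).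
Hypothesis phiP : is_frac phi V I.
Implicit Types (Q : S -> Prop) (J : R -> Prop).

(** The extension of an ideal along [phi], with a single numerator and denominator. *)
Definition ext Q := fun r => exists2 v, V v & exists2 g, Q g & phi v * r = phi g.
Definition contract J := fun g => J (phi g).

Lemma contract_ideal J : is_ideal J -> is_ideal (contract J).
Proof.
move=> iJ; split; rewrite /contract.
- by rewrite rmorph0; case: iJ.
- by move=> x y; rewrite rmorphD; apply: idealD.
- by move=> r x; rewrite rmorphM; apply: idealM.
Qed.

Lemma contract_ker J : is_ideal J -> subideal I (contract J).
Proof.
move=> iJ g Ig; rewrite /contract (_ : phi g = 0); first by case: iJ.
by apply/(frac_ker phiP); exists 1; rewrite ?mul1r //; apply: (frac1 phiP).
Qed.

Lemma frac_cancel J v r : is_ideal J -> V v -> J (phi v * r) -> J r.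
Proof.
move=> iJ /(frac_unit phiP)[u eu] h; rewrite -[r]mul1r -eu -mulrA.
exact: idealM.
Qed.

(** The contraction of [ext Q] is the saturation of [Q] by [V]. *)
Lemma ext_phi Q g : is_ideal Q -> subideal I Q ->
  ext Q (phi g) <-> exists2 v, V v & Q (v * g).
Proof.
move=> iQ sQ; split=> [[v Vv [h Qh e]]|[v Vv Qg]]; last first.
  by exists v => //; exists (v * g); rewrite ?rmorphM.
have /(frac_ker phiP)[w Vw /sQ Iw] : phi (v * g - h) = 0.
  by rewrite rmorphB rmorphM e subrr.
exists (w * v); first exact: (fracM phiP).
rewrite (_ : _ * g = w * (v * g - h) + w * h); last by ring.
by apply: idealD => //; apply: idealM.
Qed.

Lemma ext_ideal Q : is_ideal Q -> is_ideal (ext Q).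
Proof.
move=> iQ; split.
- by exists 1; [apply: (frac1 phiP)|exists 0; [case: iQ|rewrite mulr0 rmorph0]].
- move=> x y [v Vv [g Qg e]] [w Vw [h Qh e']].
  exists (v * w); first exact: (fracM phiP).
  exists (w * g + v * h); first by apply: idealD => //; apply: idealM.
  by rewrite rmorphD !rmorphM -e -e'; ring.
- move=> r x [v Vv [g Qg e]]; have [w Vw [h e']] := frac_repr phiP r.
  exists (v * w); first exact: (fracM phiP).
  exists (h * g); first exact: idealM.
  by rewrite !rmorphM -e -e'; ring.
Qed.

Lemma sub_ext Q g : Q g -> ext Q (phi g).
Proof.
by exists 1; [apply: (frac1 phiP)|exists g => //; rewrite rmorph1 mul1r].
Qed.

Lemma ext_contract J : is_ideal J -> ext (contract J) = J.
Proof.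
move=> iJ; apply: eq_ideal => r; split=> [[v Vv [g Jg e]]|Jr].
  by apply: frac_cancel Vv _ => //; rewrite e.
have [v Vv [g e]] := frac_repr phiP r; exists v => //; exists g => //.
by rewrite /contract -e; apply: idealM.
Qed.

Lemma contract_sub J J' : is_ideal J -> is_ideal J' ->
  subideal (contract J) (contract J') -> subideal J J'.
Proof.
move=> iJ iJ' h r; rewrite -(ext_contract iJ) => -[v Vv [g /h J'g e]].
by apply: (frac_cancel iJ' Vv); rewrite e.
Qed.

Lemma ext_ker : ext I = @zero_ideal R.
Proof.
apply: eq_ideal => r; split=> [[v Vv [g Ig e]]|->].
  apply: (frac_cancel (zero_is_ideal R) Vv); rewrite /zero_ideal e.
  by apply: (contract_ker (zero_is_ideal R)).
by case: (ext_ideal (frac_ideal phiP)).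
Qed.

Lemma frac_noeth : noeth S -> noeth R.
Proof.
move=> nS J iJ; have [s es] := nS _ (contract_ideal iJ).
exists (map phi s); apply: eq_ideal => r; split.
  rewrite -{1}(ext_contract iJ) => -[v Vv [g Jg e]].
  apply: (frac_cancel (span_ideal _) Vv); rewrite e.
  move: Jg; rewrite es.
  apply: (span_min (contract_ideal (span_ideal _))) => x xs.
  by apply: mem_span; apply: map_f.
apply: span_min => // x /mapP[y ys ->].
by rewrite -[J _]/(contract J y) es; apply: mem_span.
Qed.

Lemma ext_adjoin Q x : is_ideal Q -> ext (adjoin Q x) = adjoin (ext Q) (phi x).
Proof.
move=> iQ; apply: eq_ideal => r; split=> [[v Vv [g [t Qt] e]]|[t [v Vv [g Qg e]]]].
  have [u eu] := frac_unit phiP Vv.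
  exists (u * phi t); exists v => //; exists (g - t * x) => //.
  rewrite rmorphB rmorphM mulrBr e; congr (_ - _).
  by rewrite !mulrA [_ * u]mulrC eu mul1r.
have [w Vw [h e']] := frac_repr phiP t.
exists (v * w); first exact: (fracM phiP).
exists (w * g + v * h * x).
  by exists (v * h); rewrite addrK; apply: idealM.
by rewrite !(rmorphD, rmorphM) -e -e'; ring.
Qed.

Lemma wreg_ext_phi Q s : is_ideal Q -> subideal I Q ->
  wreg Q s -> wreg (ext Q) (map phi s).
Proof.
elim: s Q => //= x s IH Q iQ sQ [hx hs]; split; last first.
  rewrite -ext_adjoin //; apply: IH => //; first exact: adjoin_ideal.
  by move=> y /sQ; apply: sub_adjoin.
move=> y exy; have iE := ext_ideal iQ; have [w Vw [h e]] := frac_repr phiP y.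
apply: (frac_cancel iE Vw); rewrite e.
have /ext_phi[//|//|v Vv Qv] : ext Q (phi (x * h)).
  by rewrite rmorphM -e mulrCA; apply: idealM.
by apply/ext_phi => //; exists v => //; apply: hx; rewrite mulrCA.
Qed.

Lemma wreg_frac s : wreg I s -> wreg (@zero_ideal R) (map phi s).
Proof. by rewrite -ext_ker; apply: wreg_ext_phi => //; apply: (frac_ideal phiP). Qed.

Lemma ext_prime_phi Q g : is_prime Q -> subideal I Q -> (forall v, V v -> ~ Q v) ->
  ext Q (phi g) <-> Q g.
Proof.
move=> pQ sQ dQ; rewrite ext_phi //; last exact: prime_ideal.
split=> [[v Vv /(primeM pQ)[/(dQ _ Vv)|]//]|Qg].
by exists 1; rewrite ?mul1r //; apply: (frac1 phiP).
Qed.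

Lemma ext_prime Q : is_prime Q -> subideal I Q -> (forall v, V v -> ~ Q v) ->
  is_prime (ext Q).
Proof.
move=> pQ sQ dQ; have iE := ext_ideal (prime_ideal pQ).
split=> //; first by rewrite -(rmorph1 phi) ext_prime_phi //; apply: prime1.
move=> x y exy; have [v Vv [g eg]] := frac_repr phiP x.
have [w Vw [h eh]] := frac_repr phiP y.
have : Q (g * h).
  rewrite -ext_prime_phi // rmorphM -eg -eh mulrACA.
  exact: idealM.
case/(primeM pQ) => [Qg|Qh]; [left|right].
  by apply: (frac_cancel iE Vv); rewrite eg; apply: sub_ext.
by apply: (frac_cancel iE Vw); rewrite eh; apply: sub_ext.
Qed.

Lemma contract_prime J : is_prime J -> is_prime (contract J).
Proof.
move=> pJ; split; rewrite /contract.
- exact/contract_ideal/prime_ideal.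
- by rewrite rmorph1; apply: prime1.
- by move=> x y; rewrite rmorphM; apply: primeM.
Qed.

Lemma contract_chain l (C : nat -> R -> Prop) : chain l C ->
  chain l (fun i => contract (C i)).
Proof.
move=> [h1 h2]; split=> i il; first exact/contract_prime/h1.
split; first by move=> g; apply: (proj1 (h2 i il)).
move/contract_sub => h; apply: (proj2 (h2 i il)).
by apply: h; apply/prime_ideal/h1 => //; apply: ltnW.
Qed.

Lemma ext_strict_sub P Q : is_prime P -> is_prime Q -> subideal I P -> subideal I Q ->
  (forall v, V v -> ~ Q v) ->
  strict_sub P Q -> strict_sub (ext P) (ext Q).
Proof.
move=> pP pQ sP sQ dQ [PQ nQP].
have dP v : V v -> ~ P v by move=> /dQ nQ /PQ.
split; first by move=> r [v Vv [g /PQ Qg e]]; exists v => //; exists g.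
move=> h; apply: nQP => g /(sub_ext (Q := Q))/h.
by rewrite ext_prime_phi.
Qed.

Lemma ext_chain l (C : nat -> S -> Prop) : chain l C -> subideal I (C 0%N) ->
  (forall v, V v -> ~ C l v) -> chain l (fun i => ext (C i)).
Proof.
move=> hC sI dC.
have sC i : (i <= l)%N -> subideal I (C i).
  by move=> il g /sI; apply: (chain_sub hC).
have dCi i : (i <= l)%N -> forall v, V v -> ~ C i v.
  by move=> il v Vv Cv; apply: (dC v Vv); apply: (chain_sub hC) Cv; rewrite il /=.
case: (hC) => h1 h2; split=> i il.
  by apply: ext_prime; [apply: h1|apply: sC|apply: dCi].
apply: ext_strict_sub => //; [| | | |by apply: dCi |exact: h2].
- by apply: h1; apply: ltnW.
- exact: h1.
- by apply: sC; apply: ltnW.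
- exact: sC.
Qed.

(** If w g z is in I with w in [V], then w g is in P = I : z, and so is g, since P is prime and
    misses [V]. Hence the annihilator of [phi z] does not exceed [ext P]. *)
Lemma ext_associated P : associated I P -> (forall v, V v -> ~ P v) ->
  associated (@zero_ideal R) (ext P).
Proof.
move=> [pP [z eP]] dP.
have iI := frac_ideal phiP.
have sP : subideal I P by move=> g; rewrite eP /colon mulrC; apply: idealM.
split; first exact: ext_prime.
exists (phi z); apply: eq_ideal => r; rewrite /colon /zero_ideal.
have [v Vv [g e]] := frac_repr phiP r.
have -> : ext P r <-> P g.
  rewrite -ext_prime_phi // -e; split=> h; first by apply: idealM => //; apply/ext_ideal/prime_ideal.
  by apply: frac_cancel Vv h; apply/ext_ideal/prime_ideal.
have -> : r * phi z = 0 <-> phi (g * z) = 0.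
  rewrite rmorphM -e -mulrA; split=> [->|]; first by rewrite mulr0.
  exact: (frac_cancel (zero_is_ideal R) Vv).
rewrite (frac_ker phiP) eP; split=> [Pg|[w Vw]].
  by exists 1; rewrite ?mul1r //; apply: (frac1 phiP).
rewrite mulrA -[I _]/(colon I z _) -eP => /(primeM pP)[/(dP w Vw)//|].
by rewrite eP.
Qed.

End FractionMap.

Section Instances.
Variable R : comNzRingType.

Definition quot_map (J : idealr R) : {rmorphism R -> {ideal_quot J}} :=
  \pi_({ideal_quot J}).

Lemma quot_map_eq0 (J : idealr R) g : quot_map J g = 0 <-> g \in J.
Proof.
have -> : (0 : {ideal_quot J}) = quot_map J 0 by rewrite rmorph0.
rewrite -{2}[g]subr0 Quotient.idealrBE; exact: (rwP eqP).
Qed.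

Lemma quot_map_surj (J : idealr R) r : exists g, quot_map J g = r.
Proof. by exists (repr r); rewrite /quot_map /= reprK. Qed.

Lemma quot_frac (J : idealr R) :
  is_frac (quot_map J) (eq 1) (fun g => g \in J).
Proof.
split=> //.
- exact: idealr_is_ideal.
- by move=> v w <- <-; rewrite mulr1.
- move=> r; exists 1 => //; have [g e] := quot_map_surj r.
  by exists g; rewrite rmorph1 mul1r.
- by move=> v <-; exists 1; rewrite rmorph1 mulr1.
- move=> g; rewrite quot_map_eq0; split=> [gJ|[v <-]]; last by rewrite mul1r.
  by exists 1; rewrite ?mul1r.
Qed.

Variable P : prime_idealr R.

Definition loc_map (x : R) : localization P :=
  \pi_(localization P) (frac_of x (notin_prime1 P)).

Lemma loc_map_is_zmod_morphism : zmod_morphism loc_map.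
Proof.
move=> x y; rewrite /loc_map.
have subE (a b : localization P) : a - b = addl a (oppl b) by [].
rewrite subE -pi_oppl -pi_addl.
by apply: eq_pi_frac => /=; ring.
Qed.

Lemma loc_mulE (a b : localization P) : a * b = mull a b.
Proof. by []. Qed.

Lemma loc_map_is_monoid_morphism : monoid_morphism loc_map.
Proof.
split=> [|x y]; first by rewrite /loc_map; have -> : 1 = onel P by []; unlock onel.
by rewrite /loc_map loc_mulE -pi_mull; apply: eq_pi_frac => /=; ring.
Qed.

HB.instance Definition _ := GRing.isZmodMorphism.Build R (localization P) loc_map
  loc_map_is_zmod_morphism.
HB.instance Definition _ := GRing.isMonoidMorphism.Build R (localization P) loc_map
  loc_map_is_monoid_morphism.

Lemma loc_frac : is_frac loc_map (fun v => v \notin P) (@zero_ideal R).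
Proof.
have onelE : 1 = \pi_(localization P) (onef P).
  by have -> : 1 = onel P by []; unlock onel.
split.
- exact: zero_is_ideal.
- exact: notin_prime1.
- by move=> v w; apply: notin_prime_mul.
- elim/(@loc_ind _ P) => -[[a s] /= sP]; exists s => //; exists a.
  by rewrite /loc_map loc_mulE -pi_mull; apply: eq_pi_frac => /=; ring.
- move=> v vP; exists (\pi_(localization P) (frac_of 1 vP)).
  rewrite /loc_map loc_mulE -pi_mull onelE.
  by apply: eq_pi_frac => /=; ring.
move=> g; have -> : 0 = loc_map 0 by rewrite rmorph0.
rewrite /loc_map; split.
  move/eqP/eq_fracP => -[u uP] /=; rewrite !mulr1 mulr0 => e.
  by exists u.
move=> [v vP e]; apply/eqP/eq_fracP; exists v => //=.
by rewrite !mulr1 mulr0.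
Qed.

End Instances.

Section LocalAtMaximal.
Variables (S : comNzRingType) (J : idealr S) (P : prime_idealr {ideal_quot J}).

Definition local_map : {rmorphism S -> localization P} :=
  loc_map P \o quot_map J.

(** Presenting the local ring of the quotient over S in a single step transfers sequences and chains
    directly to and from S. *)
Lemma local_frac :
  is_frac local_map (fun v => quot_map J v \notin P) (fun g => g \in J).
Proof.
have L := loc_frac P; split.
- exact: idealr_is_ideal.
- by rewrite rmorph1; apply: notin_prime1.
- by move=> v w; rewrite rmorphM; apply: notin_prime_mul.
- move=> r; have [v vP [g e]] := frac_repr L r.
  have [v' ev] := quot_map_surj v; have [g' eg] := quot_map_surj g.
  by exists v'; [rewrite ev|exists g'; rewrite /local_map /= -!/(quot_map J _) ev eg].
- by move=> v vP; apply: (frac_unit L).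
- move=> g; rewrite (frac_ker L); split=> -[v vP e].
    have [v' ev] := quot_map_surj v; exists v'; first by rewrite ev.
    by rewrite -quot_map_eq0 rmorphM ev.
  by exists (quot_map J v) => //; rewrite /zero_ideal -rmorphM quot_map_eq0.
Qed.

End LocalAtMaximal.

(** * Depth, dimension and associated primes *)

Section LocalRings.
Variable R : comNzRingType.

(** If 1 - r x had no inverse, it would lie in some maximal ideal, that is in [M], together with
    x. *)
Lemma unique_maximal_jac (M : idealr R) x : noeth R -> unique_maximal_ideal M ->
  x \in M -> jac x.
Proof.
move=> nR uM xM r; apply: contrapT => nu.
have iA := adjoin_ideal (1 - r * x) (zero_is_ideal R).
have nA : ~ adjoin (@zero_ideal R) (1 - r * x) 1.
  by move=> [t /eqP]; rewrite subr_eq0 => /eqP e; apply: nu; exists t.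
have [N [mN sN]] := exists_maximal nR iA nA.
have eN := (uM N).1 mN.
apply: (@idealr_proper _ N); rewrite -(subrK (r * x) 1) rpredD //.
  by apply: sN; apply: mem_adjoin; apply: zero_is_ideal.
by apply: idealMr; rewrite eN.
Qed.

Lemma regular_seq_chain (M : idealr R) P s : noeth R -> unique_maximal_ideal M ->
  associated (@zero_ideal R) P -> regular_seq s -> {subset s <= M} ->
  exists2 C, chain (size s) C & C 0%N = P.
Proof.
move=> nR uM aP /regular_seqP[ws _] sM.
apply: wreg_chain ws => //; first exact: zero_is_ideal.
by move=> x /sM; apply: unique_maximal_jac.
Qed.

End LocalRings.

Section CohenMacaulayIdeals.
Variables (S : comNzRingType) (J : idealr S).
Hypothesis nS : noeth S.
Let JP g : Prop := g \in J.

Lemma associated_primeP (P : prime_idealr S) :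
  associated_prime J P <-> associated JP (fun g => g \in P).
Proof.
have key z g : (quot_map J g * quot_map J z == 0) <-> JP (g * z).
  by rewrite -rmorphM /JP -quot_map_eq0; split=> /eqP.
split=> [[z hz]|[_ [z hz]]].
  split; first exact: prime_idealr_is_prime.
  have [z' ez] := quot_map_surj z; exists z'; apply: eq_ideal => g.
  by rewrite hz -ez key.
exists (quot_map J z) => g; apply/idP/idP; rewrite key.
  by move=> gP; rewrite -[JP _]/(colon JP z g) -hz.
by rewrite -[JP _]/(colon JP z g) -hz.
Qed.

(** Localize at a maximal ideal above P. A regular sequence whose length is the depth gives a chain
    of that length starting at P; a prime over J strictly inside P would prolong it beyond the
    dimension, which equals the depth. *)
Lemma cohen_macaulay_associated_minimal (P : prime_idealr S) :
  cohen_macaulay_ideal J -> associated_prime J P -> minimal_prime J P.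
Proof.
move=> [/noetherianP nQ cm] /associated_primeP aP.
have sJP : subideal JP (fun g => g \in P).
  case: aP => _ [z ->] g gJ; rewrite /colon mulrC; apply: idealM => //.
  exact: idealr_is_ideal.
split=> // Q sJQ sQP; apply: contrapT => nPQ.
have pP := prime_idealr_is_prime P; have pQ := prime_idealr_is_prime Q.
have F := quot_frac J.
have dP v : 1 = v -> ~ v \in P by move=> <-; apply: (prime1 pP).
have iE := ext_ideal F (prime_ideal pP).
have [|M [mM sM]] := exists_maximal nQ iE.
  by apply: prime1; apply: (ext_prime F pP).
have L := local_frac M.
have dM v : quot_map J v \notin M -> ~ v \in P.
  by move=> /negP h vP; apply: h; apply: sM; apply: (sub_ext F).
have [/noetherianP nR [M' [uM [k [[s [rs sM' <-]] _] [_ kdim]]]]] := cm M mM.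
have aE := ext_associated L aP dM.
have [C hC C0] := regular_seq_chain nR uM aE rs sM'.
suff /kdim : prime_chain (localization M) (size s).+1 by rewrite ltnn.
pose EQ := ext (local_map M) (fun v => quot_map J v \notin M) (fun g => g \in Q).
apply/prime_chainP; exists (cons_chain EQ C).
apply: cons_chainP => //.
  by apply: (ext_prime L) => // v /dM nP /sQP.
by rewrite C0; apply: (ext_strict_sub L).
Qed.

(** Reduces the Cohen-Macaulay property to statements in S. In each local ring, a regular sequence
    yields a chain of the same length from a fixed associated prime of zero; this gives both depth
    at most k and dimension at least k. *)
Lemma cohen_macaulay_ideal_intro k :
  (forall M : S -> Prop, is_prime M ->
     (forall N, is_ideal N -> ~ N 1 -> subideal M N -> subideal N M) ->
     subideal JP M ->
     exists s, [/\ wreg JP s, forall x, x \in s -> M x & size s = k]) ->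
  (forall l (C : nat -> S -> Prop), chain l C -> subideal JP (C 0%N) -> (l <= k)%N) ->
  cohen_macaulay_ideal J.
Proof.
move=> hreg hdim; have F := quot_frac J.
split; first exact/noetherianP/(frac_noeth F).
move=> P mP; have L := local_frac P.
have pP := prime_idealr_is_prime P; have nR := frac_noeth L nS.
split; first exact/noetherianP.
pose m := contract (quot_map J) (fun r => r \in P).
have pm : is_prime m by apply: contract_prime.
have sm : subideal JP m by apply: (contract_ker F); apply: prime_ideal pP.
have dm v : quot_map J v \notin P -> ~ m v by move=> /negP.
have mm N : is_ideal N -> ~ N 1 -> subideal m N -> subideal N m.
  move=> iN N1 sN g Ng.
  have sJN : subideal JP N by move=> x /sm/sN.
  have extN x : ext (quot_map J) (eq 1) N (quot_map J x) <-> N x.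
    rewrite (ext_phi F) //; split=> [[v <-]|Nx]; first by rewrite mul1r.
    by exists 1; rewrite ?mul1r.
  have iE := ext_ideal F iN.
  have [|N' eN'] := exists_idealr iE.
    by rewrite -(rmorph1 (quot_map J)) extN.
  apply: (mP N' _ (quot_map J g)); last by apply/eN'/extN.
  move=> r; have [x <-] := quot_map_surj r => xP.
  by apply/eN'/extN/sN.
have pE := ext_prime L pm sm dm.
have [M eM] := exists_prime_idealr pE.
(* An element outside [M] is invertible, so [M] contains every proper ideal. *)
have Mmax (N : idealr (localization P)) x : x \in N -> x \in M.
  move=> xN; apply: contrapT => xM.
  have [v Vv [g e]] := frac_repr L x.
  have Vg : quot_map J g \notin P.
    apply/negP => gP; apply: xM; apply/eM; exists v => //; exists g => //.
  have [u eu] := frac_unit L Vg.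
  by apply: (@idealr_proper _ N); rewrite -eu -e !idealMr.
have uM : unique_maximal_ideal M.
  move=> N; split=> [mN x|eN N' _ x]; last by rewrite eN; apply: Mmax.
  by apply/idP/idP; [apply: Mmax|apply: mN => y; apply: Mmax].
exists M; split=> //.
have [s [ws sms size_s]] := hreg m pm mm sm.
have dimR l (C : nat -> localization P -> Prop) : chain l C -> (l <= k)%N.
  move=> hC; apply: (hdim l _ (contract_chain L hC)).
  by apply: (contract_ker L); apply: prime_ideal; apply (proj1 hC).
have [z [_ aQ]] : exists z, True /\ associated (@zero_ideal (localization P)) (colon (@zero_ideal _) z).
  apply: (@exists_associated _ _ (fun _ => True)) => //; first exact: zero_is_ideal.
  by exists 1 => // /eqP; rewrite oner_eq0.
have rs : regular_seq (map (local_map P) s).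
  apply/regular_seqP; split; first exact: (wreg_frac L).
  move=> h; apply: (prime1 pE); move: h; apply: span_min; first exact: prime_ideal.
  by move=> x /mapP[y ys ->]; apply: (sub_ext L); apply: sms.
have sM : {subset map (local_map P) s <= M}.
  by move=> x /mapP[y ys ->]; apply/eM; apply: (sub_ext L); apply: sms.
exists k; split.
- by exists (map (local_map P) s); rewrite size_map.
- move=> t rt tM; have [C hC _] := regular_seq_chain nR uM aQ rt tM.
  exact: dimR hC.
- apply/prime_chainP; have [C hC _] := regular_seq_chain nR uM aQ rs sM.
  by exists C; rewrite size_map size_s in hC.
by move=> l /prime_chainP[C]; apply: dimR.
Qed.

Lemma quotient_krull_dim k :
  (exists2 C : nat -> S -> Prop, chain k C & subideal JP (C 0%N)) ->
  (forall l (C : nat -> S -> Prop), chain l C -> subideal JP (C 0%N) -> (l <= k)%N) ->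
  has_krull_dim {ideal_quot J} k.
Proof.
move=> [C hC sC] hdim; have F := quot_frac J; split.
  apply/prime_chainP; eexists; apply: (ext_chain F hC sC).
  by move=> v <-; apply: prime1; apply (proj1 hC).
move=> l /prime_chainP[D hD]; apply: (hdim l _ (contract_chain F hD)).
by apply: (contract_ker F); apply: prime_ideal; apply (proj1 hD).
Qed.

End CohenMacaulayIdeals.

(** * Hilbert's basis theorem *)

Lemma surj_frac (S R : comNzRingType) (phi : {rmorphism S -> R}) :
  (forall r, exists g, phi g = r) -> is_frac phi (eq 1) (fun g => phi g = 0).
Proof.
move=> sphi; split=> //.
- split=> [|x y|r x]; first exact: rmorph0.
    by rewrite rmorphD => -> ->; rewrite addr0.
  by rewrite rmorphM => ->; rewrite mulr0.
- by move=> v w <- <-; rewrite mulr1.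
- by move=> r; exists 1 => //; have [g <-] := sphi r; exists g; rewrite rmorph1 mul1r.
- by move=> v <-; exists 1; rewrite rmorph1 mulr1.
- move=> g; split=> [e|[v <-]]; last by rewrite mul1r.
  by exists 1; rewrite ?mul1r.
Qed.

Lemma noeth_field (K : fieldType) : noeth K.
Proof.
move=> J iJ; have [[x Jx x0]|n0] := pselect (exists2 x, J x & x != 0).
  exists [:: 1]; apply: eq_ideal => y; split=> _.
    rewrite -[y]mulr1; apply: idealM; first exact: span_ideal.
    by apply: mem_span; rewrite mem_head.
  by rewrite -[y](divfK x0); apply: idealM.
exists [::]; apply: eq_ideal => y; split=> [Jy|->]; last by case: iJ.
by apply: contrapT => /eqP y0; apply: n0; exists y.
Qed.

Section HilbertBasis.
Variables (R : comNzRingType) (J : {poly R} -> Prop).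
Hypotheses (nR : noeth R) (iJ : is_ideal J).

(** The coefficient of degree k, possibly zero, rather than [lead_coef]: this makes it an ideal,
    increasing with k. *)
Definition lead_ideal k (a : R) := exists2 f, J f & (size f <= k.+1)%N /\ f`_k = a.

Lemma coef_ideal k (I : {poly R} -> Prop) : is_ideal I ->
  is_ideal (fun a => exists2 f, I f & (size f <= k.+1)%N /\ f`_k = a).
Proof.
move=> iI; split.
- by exists 0; [case: iI|rewrite size_poly0 coef0].
- move=> x y [f If [sf <-]] [g Ig [sg <-]]; exists (f + g); first exact: idealD.
  by rewrite coefD (leq_trans (size_polyD _ _)) // geq_max sf.
- move=> r x [f If [sf <-]]; exists (r%:P * f); first exact: idealM.
  by rewrite coefCM mul_polyC (leq_trans (size_scale_leq _ _)).
Qed.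

Lemma lead_ideal_le k l : (k <= l)%N -> subideal (lead_ideal k) (lead_ideal l).
Proof.
move=> kl a [f Jf [sf <-]]; exists (f * 'X^(l - k)); first exact: ideal_mulr.
split; last by rewrite coefMXn ltnNge leq_subr /= subKn.
have [->|f0] := eqVneq f 0; first by rewrite mul0r size_poly0.
rewrite (leq_trans (size_polyMleq _ _)) // size_polyXn addnS /=.
by rewrite (leq_trans (leq_add sf (leqnn _))) // addSn subnKC.
Qed.

Lemma lead_ideal_gens k : exists2 G : seq {poly R}, (forall g, g \in G -> J g) &
  forall a, lead_ideal k a -> exists2 h, span G h & (size h <= k.+1)%N /\ h`_k = a.
Proof.
have [s es] := nR (coef_ideal k iJ).
have esE a : lead_ideal k a = span s a by rewrite -es.
have /choice[c cP] : forall x, exists f, lead_ideal k x ->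
    J f /\ (size f <= k.+1)%N /\ f`_k = x.
  move=> x; have [[f Jf hf]|nx] := pselect (lead_ideal k x); last by exists 0.
  by exists f.
have sL x : x \in s -> lead_ideal k x.
  by move=> xs; rewrite esE; apply: mem_span.
exists [seq c x | x <- s] => [g /mapP[x xs ->]|a]; first by apply cP; apply: sL.
rewrite esE.
apply: (span_min (coef_ideal k (span_ideal _))) => x xs.
have [_ hx] := cP x (sL x xs).
by exists (c x) => //; apply: mem_span; apply: map_f.
Qed.

(** The ideals of leading coefficients are constant from some N on, so elements of degree at most N
    suffice: for k > N the leading term is matched by a multiple by X^(k - N). *)
Lemma poly_ideal_fin_gen : fin_gen J.
Proof.
pose F I := exists k, I = lead_ideal k.
have [||I [[N ->] _ Nmax]] := @noeth_maximal _ F (lead_ideal 0) nR.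
- by move=> I [k ->]; apply: coef_ideal.
- by exists 0%N.
have /choice[Gs GsP] : forall k, exists G : seq {poly R},
    (forall g, g \in G -> J g) /\
    (forall a, lead_ideal k a -> exists2 h, span G h & (size h <= k.+1)%N /\ h`_k = a).
  by move=> k; have [G ? ?] := lead_ideal_gens k; exists G.
pose G := flatten [seq Gs k | k <- iota 0 N.+1].
have GJ : forall g, g \in G -> J g.
  by move=> g /flatten_mapP[k _]; apply (GsP k).
have sG k : (k <= N)%N -> subideal (span (Gs k)) (span G).
  move=> kN; apply: span_min => [|x xs]; first exact: span_ideal.
  by apply: mem_span; apply/flatten_mapP; exists k => //; rewrite mem_iota.
exists G; apply: eq_ideal => f; split; last exact: span_min.
have [m] := ubnP (size f); elim: m f => // m IH f; rewrite ltnS => sf Jf.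
have [->|f0] := eqVneq f 0; first by case: (span_ideal G).
case ek: (size f) => [|k]; first by move/eqP: ek; rewrite size_poly_eq0 (negPf f0).
have Lf : lead_ideal k f`_k by exists f; rewrite ?ek.
have [h Gh [sh eh]] : exists2 h, span G h & (size h <= k.+1)%N /\ h`_k = f`_k.
  have [kN|Nk] := leqP k N.
    by have [h Gh hh] := (GsP k).2 _ Lf; exists h => //; apply: sG Gh.
  have Lf' : lead_ideal N f`_k.
    by rewrite -(Nmax (lead_ideal k)) //; [exists k|apply/lead_ideal_le/ltnW].
  have [h Gh [sh eh]] := (GsP N).2 _ Lf'.
  exists (h * 'X^(k - N)).
    by apply: ideal_mulr; [apply: span_ideal|apply: sG Gh].
  split; last by rewrite coefMXn ltnNge leq_subr /= subKn // ltnW.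
  rewrite (leq_trans (size_polyMleq _ _)) // size_polyXn addnS /=.
  by rewrite (leq_trans (leq_add sh (leqnn _))) // addSn subnKC // ltnW.
rewrite -(subrK h f); apply: idealD => //; first exact: span_ideal.
apply: IH; last by apply: idealB => //; move: Gh; apply: span_min.
apply: leq_trans sf; rewrite ek ltnS; apply/leq_sizeP => j.
rewrite leq_eqVlt coefB => /predU1P[<-|kj]; first by rewrite eh subrr.
by rewrite !nth_default ?subrr // (leq_trans _ kj) // ek.
Qed.

End HilbertBasis.

Lemma poly_noeth (R : comNzRingType) : noeth R -> noeth {poly R}.
Proof. by move=> nR J; apply: poly_ideal_fin_gen. Qed.

Lemma mpoly_subring_ind (R : comNzRingType) n (T : {mpoly R[n]} -> Prop) :
  (forall c, T c%:MP) -> (forall i, T 'X_i) ->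
  (forall p q, T p -> T q -> T (p + q)) -> (forall p q, T p -> T q -> T (p * q)) ->
  forall p, T p.
Proof.
move=> TC TX TD TM p; rewrite [p]mpolyE.
apply: big_ind => [||m _]; [by rewrite -(mpolyC0 n R)|exact: TD|].
rewrite -mul_mpolyC; apply: (TM) => //; rewrite mpolyXE_id.
apply: big_ind => [||i _]; [by rewrite -(mpolyC1 n R)|exact: TM|].
elim: (m i) => [|k IH]; first by rewrite expr0 -(mpolyC1 n R).
by rewrite exprS; apply: TM.
Qed.

Lemma mpoly_noeth (K : fieldType) n : noeth {mpoly K[n]}.
Proof.
elim: n => [|n IH].
  apply: (frac_noeth (surj_frac (phi := @mpolyC 0 K) _)); last exact: noeth_field.
  by move=> p; exists p@_0%MM; apply/esym/nvar0_mpolyC.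
pose phi : {rmorphism {poly {mpoly K[n]}} -> {mpoly K[n.+1]}} :=
  horner_eval 'X_(ord_max) \o map_poly (@mwiden n K).
apply: (frac_noeth (surj_frac (phi := phi) _)); last exact: poly_noeth.
apply: mpoly_subring_ind => [c|i|_ _ [p <-] [q <-]|_ _ [p <-] [q <-]].
- by exists (c%:MP)%:P; rewrite /phi /= map_polyC /= /horner_eval hornerC mwidenC.
- have [j ->|->] := unliftP ord_max i; last first.
    by exists 'X; rewrite /phi /= map_polyX /horner_eval hornerX.
  exists ('X_j)%:P; rewrite /phi /= map_polyC /= /horner_eval hornerC mwidenX.
  rewrite mnmwiden1; congr 'X_[U_(_)].
  by apply: val_inj; rewrite /= /bump leqNgt ltn_ord.
- by exists (p + q); rewrite rmorphD.
- by exists (p * q); rewrite rmorphM.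
Qed.

(** * Dimension of polynomial rings *)

Section Support.
Variables (K : fieldType) (n : nat).
Implicit Types (p q : {mpoly K[n]}) (b : 'I_n -> nat) (A : {set 'I_n}).

Definition supp_le b p := forall m, m \in msupp p -> forall i, (m i <= b i)%N.

Lemma supp_leW b b' p : (forall i, b i <= b' i)%N -> supp_le b p -> supp_le b' p.
Proof. by move=> h hp m /hp/(_ _) hm i; apply: leq_trans (hm i) (h i). Qed.

Lemma supp_leD b p q : supp_le b p -> supp_le b q -> supp_le b (p + q).
Proof. by move=> hp hq m /msuppD_le; rewrite mem_cat => /orP[/hp|/hq]. Qed.

Lemma supp_leM b b' p q : supp_le b p -> supp_le b' q ->
  supp_le (fun i => b i + b' i)%N (p * q).
Proof.
move=> hp hq m /msuppM_le/allpairsP[[m1 m2] /= [/hp h1 /hq h2 ->]] i.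
by rewrite mnmDE leq_add.
Qed.

Lemma supp_leC b c : supp_le b c%:MP.
Proof.
move=> m; rewrite msuppC; case: ifP => // _; rewrite inE => /eqP -> i.
by rewrite mnm0E.
Qed.

(** The bound for polynomials free of the variables in [A] and of degree at most [D] in each other
    variable. *)
Definition off A (D : nat) i := if i \in A then 0%N else D.

Lemma supp_off_exp A D p k : supp_le (off A D) p -> supp_le (off A (D * k)) (p ^+ k).
Proof.
move=> hp; elim: k => [|k IH]; first by rewrite expr0 -(mpolyC1 n K); apply: supp_leC.
rewrite exprS; apply: supp_leW (supp_leM hp IH) => i.
by rewrite /off; case: ifP => //; rewrite mulnS.
Qed.

Lemma supp_off_prod A (I : finType) (P : pred I) (F : I -> {mpoly K[n]}) (D : I -> nat) :
  (forall j, supp_le (off A (D j)) (F j)) ->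
  supp_le (off A (\sum_(j | P j) D j)) (\prod_(j | P j) F j).
Proof.
move=> h; elim/big_rec2: _ => [|j p d _ IH]; first by rewrite -(mpolyC1 n K); apply: supp_leC.
apply: supp_leW (supp_leM (h j) IH) => i.
by rewrite /off; case: ifP.
Qed.

(** Setting the variables in [A] to 0, as an endomorphism: it chooses representatives modulo these
    variables, and with [~: U] it is the retraction onto K[x_U]. *)
Definition kill A : {rmorphism {mpoly K[n]} -> {mpoly K[n]}} :=
  mmap (@mpolyC n K) (fun i => if i \in A then 0 else 'X_i).

Lemma killC A c : kill A c%:MP = c%:MP.
Proof. exact: mmapC. Qed.

Lemma killX A i : kill A 'X_i = if i \in A then 0 else 'X_i.
Proof. by rewrite /kill /= mmapX mmap1U. Qed.

Lemma kill_supp A p : exists D, supp_le (off A D) (kill A p).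
Proof.
elim/mpoly_subring_ind: p => [c|i|p q [D hp] [D' hq]|p q [D hp] [D' hq]].
- by exists 0%N; rewrite killC; apply: supp_leC.
- exists 1%N; rewrite killX; case: ifP => iA.
    by rewrite -(mpolyC0 n K); apply: supp_leC.
  move=> m; rewrite msuppX inE => /eqP -> j; rewrite mnm1E /off.
  by case: (eqVneq i j) => [<-|]; rewrite ?iA.
- exists (D + D')%N; rewrite rmorphD; apply: supp_leD.
    by apply: supp_leW hp => i; rewrite /off; case: ifP => // _; rewrite leq_addr.
  by apply: supp_leW hq => i; rewrite /off; case: ifP => // _; rewrite leq_addl.
- exists (D + D')%N; rewrite rmorphM; apply: supp_leW (supp_leM hp hq) => i.
  by rewrite /off; case: ifP.
Qed.

Lemma kill_mod A (J : {mpoly K[n]} -> Prop) p : is_ideal J ->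
  (forall i, i \in A -> J 'X_i) -> J (p - kill A p).
Proof.
move=> iJ JA; elim/mpoly_subring_ind: p => [c|i|p q hp hq|p q hp hq].
- by rewrite killC subrr; case: iJ.
- rewrite killX; case: ifP => iA; first by rewrite subr0; apply: JA.
  by rewrite subrr; case: iJ.
- by rewrite rmorphD opprD addrACA; apply: idealD.
- rewrite rmorphM (_ : _ - _ = q * (p - kill A p) + kill A p * (q - kill A q)); last by ring.
  by apply: idealD => //; apply: idealM.
Qed.

End Support.

Lemma linear_dependence (K : fieldType) (E G : finType) (F : E -> G -> K) :
  (#|G| < #|E|)%N ->
  exists2 c : E -> K, (exists e, c e != 0) & forall g, \sum_e c e * F e g = 0.
Proof.
move=> lt_GE; pose M := \matrix_(i < #|E|, j < #|G|) F (enum_val i) (enum_val j).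
have : kermx M != 0.
  rewrite kermx_eq0 /row_free neq_ltn; apply/orP; left.
  exact: leq_ltn_trans (rank_leq_col M) lt_GE.
case/matrix0Pn => i0 [j0 kij]; pose c e := kermx M i0 (enum_rank e).
exists c; first by exists (enum_val j0); rewrite /c enum_valK.
move=> g; have := mulmx_ker M => /matrixP/(_ i0 (enum_rank g)).
rewrite !mxE => e; rewrite -[RHS]e (reindex_onto enum_val enum_rank) /=; last first.
  by move=> e1 _; rewrite enum_rankK.
apply: eq_big => [j|j _]; first by rewrite enum_valK eqxx.
by rewrite /c enum_valK [M _ _]mxE enum_rankK.
Qed.

Section Dimension.
Variables (K : fieldType) (n : nat) (A : {set 'I_n}).

Lemma algebraic_dependence r (f : 'I_r -> {mpoly K[n]}) D :
  (forall j, supp_le (off A D) (f j)) -> (n - #|A| < r)%N ->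
  exists N, exists2 c : {ffun 'I_r -> 'I_N.+1} -> K, (exists e, c e != 0) &
    \sum_e c e *: \prod_j f j ^+ e j = 0.
Proof.
move=> hf; set s := (n - #|A|)%N => sr.
(* The (N+1)^r products involve at most (B+1)^s monomials, having degree at most B = D r N in each
   variable outside [A]. As B+1 <= (N+1)(D r+1), this N gives (B+1)^s <= (N+1)^s N < (N+1)^(s+1) <=
   (N+1)^r. *)
pose N := ((D * r).+1 ^ s)%N; pose B := (D * r * N)%N; exists N.
pose U := {i : 'I_n | i \notin A}.
pose mon (g : {ffun U -> 'I_B.+1}) : 'X_{1..n} :=
  [multinom if insub i is Some u then nat_of_ord (g u) else 0%N | i < n].
have cU : #|{: U}| = s.
  by rewrite card_sig /s -[X in (X - _)%N](card_ord n) -(cardC A) addKn; apply: eq_card => i; rewrite !inE.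
have [|c c0 hc] := @linear_dependence K {ffun 'I_r -> 'I_N.+1} {ffun U -> 'I_B.+1}
    (fun e g => (\prod_j f j ^+ e j)@_(mon g)).
  rewrite !card_ffun !card_ord cU.
  have BN : (B.+1 <= N.+1 * (D * r).+1)%N.
    by rewrite /B mulnC; apply: ltn_mul.
  apply: (@leq_ltn_trans (N.+1 ^ s * N)%N).
    rewrite {2}/N -expnMn; case: (s) => // s'; rewrite leq_exp2r //.
  by rewrite (@leq_trans (N.+1 ^ s.+1)) // ?leq_pexp2l // expnSr ltn_pmul2l ?expn_gt0.
exists c => //; apply/mpolyP => m; rewrite mcoeff0 raddf_sum /=.
under eq_bigr => e _ do rewrite mcoeffZ.
have [/forallP mB|/forallPn[i ni]] := boolP [forall i, (m i <= off A B i)%N].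
  pose g : {ffun U -> 'I_B.+1} := [ffun u => inord (m (val u))].
  rewrite -[RHS](hc g); apply: eq_bigr => e _; congr (_ * _@__).
  apply/mnmP => i; rewrite mnmE; case: insubP => [u iA ei|].
    rewrite /g ffunE inordK ei // ltnS.
    by have := mB i; rewrite /off (negPf iA).
  rewrite negbK => iA; have := mB i; rewrite /off iA leqn0.
  by move/eqP.
apply: big1 => e _; rewrite memN_msupp_eq0 ?mulr0 //; apply/negP => hm.
case/negP: ni; have /(_ m hm i) := @supp_off_prod K n A _ xpredT _ _
  (fun j => supp_off_exp (k := e j) (hf j)).
move/leq_trans; apply; rewrite /off; case: ifP => // _.
rewrite -big_distrr /= /B -mulnA leq_mul2l; apply/orP; right.
rewrite -[X in (X * N)%N](card_ord r) -sum_nat_const; apply: leq_sum => j _.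
by rewrite -ltnS.
Qed.

(* Coquand-Lombardi: peel off the lexicographically least monomial of an
   algebraic relation between elements [f_i] of [C_(i+1)] outside [C_i]. *)
Lemma chain_bound l (C : nat -> {mpoly K[n]} -> Prop) : chain l C ->
  (forall i, i \in A -> C 0%N 'X_i) -> (l <= n - #|A|)%N.
Proof.
move=> hC CA; rewrite leqNgt; apply/negP => lt_l.
set r := (n - #|A|).+1 in lt_l.
have pC i : (i <= l)%N -> is_prime (C i) by apply (proj1 hC).
have /choice[f0 f0P] : forall j : 'I_r, exists f, C j.+1 f /\ ~ C j f.
  move=> j; have jl : (j < l)%N by apply: leq_trans (ltn_ord j) lt_l.
  apply: contrapT => h; apply: (proj2 (proj2 hC j jl)) => x Cx.
  by apply: contrapT => nx; apply: h; exists x.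
(* The variables in [A] lie in every prime of the chain: removing them preserves all memberships and
   leaves n - #|A| variables for r elements. *)
pose f j := kill K A (f0 j).
have fP (j : 'I_r) : C j.+1 (f j) /\ ~ C j (f j).
  have jl : (j < l)%N by apply: leq_trans (ltn_ord j) lt_l.
  have key i : (i <= l)%N -> C i (f0 j - f j).
    move=> il; apply: kill_mod; first exact/prime_ideal/pC.
    by move=> k /CA; apply: (chain_sub hC); rewrite il.
  have [h1 h2] := f0P j; split.
    rewrite -[f j](subKr (f0 j)); apply: idealB => //; last exact: key.
    exact/prime_ideal/pC.
  move=> h; apply: h2; apply: (ideal_sub_eq _ (key _ (ltnW jl)) h).
  exact/prime_ideal/pC/ltnW.
have [D fD] : exists D, forall j, supp_le (off A D) (f j).
  have /choice[d hd] : forall j, exists D, supp_le (off A D) (f j).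
    by move=> j; apply: kill_supp.
  exists (\max_j d j) => j; apply: supp_leW (hd j) => i.
  by rewrite /off; case: ifP => // _; apply: leq_bigmax.
have [N [c [e0 ce0] hc]] := algebraic_dependence fD (leqnn _).
(* Invariant: [E] holds exponents of non-zero terms that agree below i, and the part of the relation
   indexed by [E], freed of the factors f_j with j < i, lies in C_i. *)
have main i : (i <= r)%N -> exists E : {set {ffun 'I_r -> 'I_N.+1}},
   [/\ E != set0, forall e, e \in E -> c e != 0,
       forall e e' (j : 'I_r), e \in E -> e' \in E -> (j < i)%N -> e j = e' j
     & C i (\sum_(e in E) c e *: \prod_(j < r | (i <= j)%N) f j ^+ e j)].
  elim: i => [|i IH] ir.
    exists [set e | c e != 0]; split=> //.
    - by apply/set0Pn; exists e0; rewrite inE.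
    - by move=> e; rewrite inE.
    - suff -> : \sum_(e in [set e | c e != 0]) c e *: \prod_(j < r | (0 <= j)%N) f j ^+ e j = 0.
        by case: (prime_ideal (pC 0%N isT)).
      rewrite -[RHS]hc [RHS](bigID (fun e : {ffun 'I_r -> 'I_N.+1} => c e != 0)) /= [X in _ + X]big1 ?addr0.
        by apply: eq_bigl => e; rewrite inE.
      by move=> e; rewrite negbK => /eqP ->; rewrite scale0r.
  have [E [/set0Pn[e1 e1E] Ec Eeq CE]] := IH (ltnW ir).
  pose j0 : 'I_r := Ordinal ir.
  pose em := [arg min_(e < e1 in E) nat_of_ord (e j0)].
  have [emE emin] : em \in E /\ forall e, e \in E -> (em j0 <= e j0)%N.
    by rewrite /em; case: arg_minnP.
  have il : (i < l)%N by apply: leq_trans ir lt_l.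
  have jpred (j : 'I_r) : (i <= j)%N && (j != j0) = (i < j)%N.
    by rewrite ltn_neqAle eq_sym andbC.
  pose T (e : {ffun 'I_r -> 'I_N.+1}) := \prod_(j < r | (i < j)%N) f j ^+ e j.
  pose Y := \sum_(e in E) c e *: (f j0 ^+ (e j0 - em j0) * T e).
  (* The common power of f_i cancels, as f_i is outside the prime C_i. *)
  have CY : C i Y.
    have : C i (f j0 ^+ em j0 * Y).
      rewrite /Y mulr_sumr; move: CE; congr (C i _); apply: eq_bigr => e eE.
      rewrite -scalerAr mulrA -exprD subnKC ?emin // (bigD1 j0) //=.
      by congr (_ *: (_ * _)); apply: eq_bigl => j; rewrite jpred.
    have [_ nf] := fP j0; elim: (nat_of_ord (em j0)) => [|k IHk]; first by rewrite expr0 mul1r.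
    by rewrite exprS -mulrA => /(primeM (pC i (ltnW il)))[|/IHk].
  have CY' : C i.+1 Y by apply: (proj1 (proj2 hC i il)).
  exists [set e in E | e j0 == em j0]; split.
  - by apply/set0Pn; exists em; rewrite inE emE eqxx.
  - by move=> e; rewrite inE => /andP[/Ec].
  - move=> e e' j; rewrite !inE => /andP[eE /eqP ej] /andP[eE' /eqP ej'].
    rewrite ltnS leq_eqVlt => /predU1P[ji|]; last exact: Eeq.
    by have -> : j = j0 by [apply: val_inj]; rewrite ej ej'.
  have iC : is_ideal (C i.+1) by apply/prime_ideal/pC.
  move: CY'; rewrite /Y (bigID (fun e : {ffun 'I_r -> 'I_N.+1} => e j0 == em j0)) /=.
  set Y1 := (X in C _ (X + _)); set Y2 := (X in C _ (_ + X)) => CY'.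
  (* Terms whose exponent at i is not minimal keep a factor f_i, which lies in C_(i+1). *)
  have CY2 : C i.+1 Y2.
    apply: ideal_sum => // e /andP[eE ne]; rewrite -mul_mpolyC; apply: idealM => //.
    apply: ideal_mulr => //; have : (0 < e j0 - em j0)%N.
      by rewrite subn_gt0 ltn_neqAle eq_sym ne emin.
    case: (e j0 - em j0)%N => // k _; rewrite exprS; apply: ideal_mulr => //.
    by case: (fP j0).
  have : C i.+1 Y1 by rewrite -(addrK Y2 Y1); apply: idealB.
  congr (C _ _); apply: eq_big => [e|e /andP[_ /eqP ->]]; first by rewrite inE.
  by rewrite subnn expr0 mul1r.
(* A single exponent is left, so a non-zero constant lies in C_r. *)
have [E [/set0Pn[e eE] Ec Eeq]] := main r (leqnn r).
have -> : E = [set e].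
  apply/setP => e'; rewrite inE; apply/idP/eqP => [e'E|->//].
  by apply/ffunP => j; apply: Eeq.
rewrite big_set1 big_pred0 => [Ce|j]; last by rewrite leqNgt ltn_ord.
have pr := pC r lt_l; apply: (prime1 pr).
rewrite -[1](scale1r (1 : {mpoly K[n]})) -(mulVf (Ec _ eE)) -scalerA -mul_mpolyC.
by apply: idealM => //; apply: prime_ideal.
Qed.

End Dimension.

(** * Zariski's lemma *)

Definition evX (K : fieldType) n (i : 'I_n) : {rmorphism {poly K} -> {mpoly K[n]}} :=
  horner_eval 'X_i \o map_poly (@mpolyC n K).

Section EvX.
Variables (K : fieldType) (n : nat).
Implicit Types (i j : 'I_n) (U : {set 'I_n}).

Lemma evXC i c : evX K i c%:P = c%:MP.
Proof. by rewrite /evX /= map_polyC /horner_eval /= hornerC. Qed.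

Lemma evX_X i : evX K i 'X = 'X_i.
Proof. by rewrite /evX /= map_polyX /horner_eval hornerX. Qed.

Lemma mpoly_morph_eq (R : comNzRingType) (f g : {rmorphism {mpoly K[n]} -> R}) :
  (forall c, f c%:MP = g c%:MP) -> (forall i, f 'X_i = g 'X_i) -> f =1 g.
Proof.
move=> fgC fgX; elim/mpoly_subring_ind => // p q hp hq.
  by rewrite !rmorphD hp hq.
by rewrite !rmorphM hp hq.
Qed.

(** Expansion in powers of x_i; the coefficients stay in the same ring but are free of x_i. *)
Definition as_poly i : {rmorphism {mpoly K[n]} -> {poly {mpoly K[n]}}} :=
  mmap (polyC \o @mpolyC n K) (fun j => if j == i then 'X else ('X_j)%:P).

Lemma as_polyC i c : as_poly i c%:MP = (c%:MP)%:P.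
Proof. exact: mmapC. Qed.

Lemma as_polyX i j : as_poly i 'X_j = if j == i then 'X else ('X_j)%:P.
Proof. by rewrite /as_poly /= mmapX mmap1U. Qed.

Lemma as_polyK i p : (as_poly i p).['X_i] = p.
Proof.
apply: (mpoly_morph_eq (f := horner_eval 'X_i \o as_poly i) (g := idfun)) => [c|j] /=.
  by rewrite as_polyC /horner_eval hornerC.
by rewrite as_polyX /horner_eval; case: eqP => [->|_]; rewrite ?hornerX ?hornerC.
Qed.

Lemma as_poly_kill U j p :
  map_poly (kill K (~: U)) (as_poly j (kill K (~: (j |: U)) p))
    = as_poly j (kill K (~: (j |: U)) p).
Proof.
apply: (mpoly_morph_eq (f := map_poly (kill K (~: U)) \o as_poly j \o kill K (~: (j |: U)))
   (g := as_poly j \o kill K (~: (j |: U)))) => [c|k] /=.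
  by rewrite killC as_polyC map_polyC /= killC.
rewrite killX !inE negb_or; case: eqP => [->|/eqP kj] /=.
  by rewrite as_polyX eqxx map_polyX.
case: ifP => kU /=; first by rewrite !rmorph0.
by rewrite as_polyX (negPf kj) map_polyC /= killX inE kU.
Qed.

Lemma kill_idem U p : kill K U (kill K U p) = kill K U p.
Proof.
apply: (mpoly_morph_eq (f := kill K U \o kill K U) (g := kill K U)) => [c|j] /=.
  by rewrite !killC.
by rewrite killX; case: ifP => jU; rewrite ?rmorph0 ?killX ?jU.
Qed.

Lemma kill_evX i p : exists g, kill K (~: [set i]) p = evX K i g.
Proof.
elim/mpoly_subring_ind: p => [c|j|p q [g hg] [g' hg']|p q [g hg] [g' hg']].
- by exists c%:P; rewrite evXC killC.
- rewrite killX !inE; case: eqP => [->|_].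
    by exists 'X; rewrite evX_X.
  by exists 0; rewrite rmorph0.
- by exists (g + g'); rewrite !rmorphD hg hg'.
- by exists (g * g'); rewrite !rmorphM hg hg'.
Qed.

End EvX.

(** * Integral elements *)

Lemma integral_root_lead (R L : comNzRingType) (f : {rmorphism R -> L}) p u c :
  c * lead_coef p = 1 -> integralOver f c -> (forall i, integralOver f p`_i) ->
  root p u -> integralOver f u.
Proof.
move=> cp ic ip pu.
have sz : size (c *: p) = size p.
  apply/eqP; rewrite eqn_leq size_scale_leq leqNgt; apply/negP => lt_cp.
  have : (c *: p)`_(size p).-1 = 0.
    apply: nth_default; rewrite -ltnS prednK // (leq_ltn_trans _ lt_cp) //.
  by rewrite coefZ -lead_coefE cp => /eqP; rewrite oner_eq0.
have mon : c *: p \is monic by rewrite monicE lead_coefE sz coefZ -lead_coefE cp.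
apply: (integral_root_monic mon).
  by rewrite /root hornerZ (eqP pu) mulr0.
by apply/integral_poly => i; rewrite coefZ; apply: integral_mul.
Qed.

(** Multiplying the integral equation of w, of degree e, by f(x)^e turns each w^i into f(x)^(e-i),
    so 1 becomes f(x) times an element of the image of f. *)
Lemma inverse_of_integral (R L : comNzRingType) (f : {rmorphism R -> L}) p x w :
  w * f x = 1 -> p \is monic -> (map_poly f p).[w] = 0 ->
  exists t, f x * f t = 1.
Proof.
move=> wx mon; set e := (size p).-1.
have sp : size p = e.+1 by rewrite prednK // size_poly_gt0 monic_neq0.
have pe : p`_e = 1 by rewrite -lead_coefE (monicP mon).
have sq : (size (map_poly f p) <= e.+1)%N by rewrite -sp size_poly.
have qe : (map_poly f p)`_e = 1 by rewrite coef_map /= pe rmorph1.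
rewrite (horner_coef_wide w sq) big_ord_recr /= qe mul1r.
move=> e0; exists (- \sum_(i < e) p`_i * x ^+ (e - i.+1)).
have we : w ^+ e * f x ^+ e = 1 by rewrite -exprMn wx expr1n.
move/eqP: e0; rewrite addrC addr_eq0 => /eqP e0.
rewrite -[RHS]we e0 rmorphN rmorph_sum mulNr mulrN; congr (- _).
rewrite mulr_sumr mulr_suml; apply: eq_bigr => i _.
rewrite coef_map rmorphM rmorphXn /= -[X in _ = _ * f x ^+ X](subnKC (ltn_ord i)) exprD exprS.
have wi : w ^+ i * f x ^+ i = 1 by rewrite -exprMn wx expr1n.
rewrite -[LHS]mul1r -wi; ring.
Qed.

Section Zariski.
Variables (K : fieldType) (n : nat) (M : prime_idealr {mpoly K[n]}).
Hypothesis Mmax : forall p, p \notin M -> exists q, q * p - 1 \in M.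

Let pi : {rmorphism {mpoly K[n]} -> {ideal_quot M}} := quot_map M.

Let pi_inv p : p \notin M -> exists q, pi q * pi p = 1.
Proof.
move=> /Mmax[q]; rewrite -quot_map_eq0 rmorphB rmorph1 rmorphM => /eqP.
by rewrite subr_eq0 => /eqP; exists q.
Qed.

Lemma mpoly_unit_const (u v : {mpoly K[n]}) : u * v = 1 -> exists c, u = c%:MP.
Proof.
move=> uv; have u0 : u != 0 by apply/eqP => e; move/eqP: uv; rewrite e mul0r eq_sym oner_eq0.
have v0 : v != 0 by apply/eqP => e; move/eqP: uv; rewrite e mulr0 eq_sym oner_eq0.
have su : (msize u <= 1)%N.
  have := msizeM u0 v0; rewrite uv msize1.
  have: (0 < msize v)%N by rewrite lt0n msize_poly_eq0.
  by case: (msize v) => // k _; rewrite addnS /= => ->; apply: leq_addr.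
by exists u@_0%MM; apply: msize1_polyC.
Qed.

Lemma not_const_1Xh (h : {mpoly K[n]}) i c : h != 0 -> 1 + 'X_i * h <> c%:MP.
Proof.
move=> h0 ec; have Xh0 : ('X_i * h)@_0%MM = 0.
  rewrite memN_msupp_eq0 //; apply/negP => /msuppM_le/allpairsP[[m1 m2] /= []].
  rewrite msuppX inE => /eqP -> _ /eqP.
  by rewrite eq_sym mnmD_eq0 mnm1_eq0.
have : 'X_i * h = 0.
  have e1 : 'X_i * h = (c - 1)%:MP by rewrite mpolyCB mpolyC1 -ec; ring.
  by move: Xh0; rewrite e1 mcoeffC eqxx mulr1 => ->; rewrite mpolyC0.
by move/eqP; rewrite mulf_eq0 (negPf h0) orbF -msupp_eq0 msuppX.
Qed.

(** Modulo u = 1 + x_i h, the element - x_i h is 1. If u divided a power of h, it would divide that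
    power of x_i h, hence 1, and be constant. *)
Lemma not_dvd_exp (h v : {mpoly K[n]}) i N :
  h != 0 -> h ^+ N <> (1 + 'X_i * h) * v.
Proof.
move=> h0 e; set u := 1 + 'X_i * h in e.
suff [c ec] : exists c, u = c%:MP by apply: (not_const_1Xh h0 ec).
have : (- ('X_i * h)) ^+ N = u * ((- 'X_i) ^+ N * v).
  by rewrite -mulNr exprMn e; ring.
have -> : - ('X_i * h) = 1 - u by rewrite /u; ring.
have [w ->] : exists w, (1 - u) ^+ N = 1 - u * w.
  elim: (N) => [|k [w IH]]; first by exists 0; rewrite expr0; ring.
  by exists (1 + w - u * w); rewrite exprS IH; ring.
set t := _ * v => /eqP; rewrite subr_eq => /eqP e'.
by apply: (@mpoly_unit_const _ (t + w)); rewrite e'; ring.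
Qed.

(* If x_i were transcendental modulo M, extend it to a maximal set U of
   variables independent modulo M.  The field S/M is then integral over
   K[x_U][1/h], and inverting 1 + x_i h there gives h^N = (1 + x_i h) v in
   K[x_U]. *)
Lemma zariski i : exists g : {poly K},
  [/\ g \is monic, (1 < size g)%N, g`_0 = 0 & evX K i g \in M].
Proof.
pose k U := kill K (~: U) : {rmorphism {mpoly K[n]} -> {mpoly K[n]}}.
have kD U p : k U (k U p) = k U p.
  exact: kill_idem.
(* The fixed points of [k U] form K[x_U]; independence says that K[x_U] meets M only in 0. *)
pose indep U := `[< forall p, k U p = p -> p \in M -> p = 0 >].
have [iI|/asboolPn nI] := boolP (indep [set i]); last first.
  have [p ep [pM p0]] : exists2 p, k [set i] p = p & p \in M /\ p <> 0.
    apply: contrapT => h; apply: nI => p ep pM; apply: contrapT => p0.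
    by apply: h; exists p.
  have [g eg] := kill_evX i p; rewrite -/(k _ _) ep in eg.
  have g0 : g != 0 by apply/eqP => g0; apply: p0; rewrite eg g0 rmorph0.
  pose g1 := (lead_coef g)^-1 *: g.
  have mg1 : g1 \is monic by rewrite monicE lead_coefZ mulVf // lead_coef_eq0.
  (* The extra factor X makes the constant term vanish. *)
  exists ('X * g1); split.
  - by rewrite rpredM // monicX.
  - rewrite mulrC size_mulX ?monic_neq0 // ltnS size_poly_gt0 monic_neq0 //.
  - by rewrite coefXM.
  - rewrite rmorphM idealMr // /g1 -mul_polyC rmorphM evXC idealMr //.
    by rewrite -eg.
exfalso; have [U /maxsetP[/asboolP UI Umax] iU] := maxset_exists iI.
rewrite sub1set in iU.
(* By maximality of [U], x_j satisfies modulo M an equation over K[x_U]; its leading coefficient is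
   non-zero in K[x_U], hence outside M. *)
have lP j : exists l, j \notin U -> [/\ k U l = l, l \notin M &
   exists F, [/\ map_poly (k U) F = F, lead_coef F = l & F.['X_j] \in M]].
  have [jU|jU] := boolP (j \in U); first by exists 0.
  have [p ep [pM p0]] : exists2 p, k (j |: U) p = p & p \in M /\ p <> 0.
    apply: contrapT => h; suff e : j |: U = U by rewrite -e setU11 in jU.
    apply: Umax; last exact: subsetUr.
    apply/asboolP => p ep pM; apply: contrapT => p0; apply: h.
    by exists p.
  pose F := as_poly K j p; have eF : map_poly (k U) F = F.
    by rewrite /F -ep /k as_poly_kill.
  have F0 : F != 0 by apply/eqP => F0; apply: p0; rewrite -(as_polyK j p) -/F F0 horner0.
  have el : k U (lead_coef F) = lead_coef F by rewrite lead_coefE -coef_map eF.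
  exists (lead_coef F) => _; split=> //; last by exists F; rewrite as_polyK.
  apply/negP => /(UI _ el)/eqP; by rewrite lead_coef_eq0 (negPf F0).
have {lP}[l lP] := choice lP.
pose h := \prod_(j | j \notin U) l j.
have kh : k U h = h.
  by rewrite rmorph_prod; apply: eq_bigr => j /lP[].
have hM : h \notin M.
  rewrite /h; elim/big_ind: _ => [|x y|j /lP[]//]; first exact: notin_prime1.
  exact: notin_prime_mul.
have h0 : h != 0 by apply: contraNneq hM => ->; apply: idealr0.
have [hi ehi] := pi_inv hM; set y := pi hi in ehi.
(* The image of [phi] is K[x_U][1/h]: coefficients pass through [k U], and X goes to 1/h. *)
pose phi : {rmorphism {poly {mpoly K[n]}} -> {ideal_quot M}} :=
  horner_eval y \o map_poly (pi \o k U).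
have phiC p : phi p%:P = pi (k U p) by rewrite /phi /= map_polyC /horner_eval hornerC.
have phiX : phi 'X = y by rewrite /phi /= map_polyX /horner_eval hornerX.
have intk p : k U p = p -> integralOver phi (pi p).
  by move=> <-; rewrite -phiC; apply: integral_id.
have intX j : integralOver phi (pi 'X_j).
  have [jU|jU] := boolP (j \in U); first by apply: intk; rewrite /k killX inE jU.
  have [kl lM [F [kF lF FM]]] := lP j jU.
  pose h' := \prod_(j' | (j' \notin U) && (j' != j)) l j'.
  have eh : h = l j * h' by rewrite /h (bigD1 j).
  have kh' : k U h' = h' by rewrite rmorph_prod; apply: eq_bigr => j' /andP[/lP[]].
  have clj : pi h' * y * pi (l j) = 1 by rewrite -ehi eh rmorphM; ring.
  have lF' : lead_coef (map_poly pi F) = pi (l j).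
    rewrite -lF; apply: lead_coef_map_eq; rewrite lF.
    by apply: contra lM => /eqP/quot_map_eq0.
  apply: (@integral_root_lead _ _ phi (map_poly pi F) _ (pi h' * y)).
  - by rewrite lF'.
  - by apply: integral_mul; [apply: intk|rewrite -phiX; apply: integral_id].
  - move=> a; rewrite coef_map; apply: intk.
    by rewrite -{2}kF coef_map.
  - by rewrite /root horner_map; apply/eqP/quot_map_eq0.
have intA p : integralOver phi (pi p).
  elim/mpoly_subring_ind: p => [c|//|p q hp hq|p q hp hq].
  - by apply: intk; rewrite /k killC.
  - by rewrite (rmorphD pi); have := integral_add hp hq.
  - by rewrite (rmorphM pi); have := integral_mul hp hq.
pose u := 1 + 'X_i * h.
have ku : k U u = u by rewrite rmorphD rmorph1 rmorphM kh /k killX inE iU.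
have u0 : u != 0.
  by apply/eqP => eu; apply: (@not_const_1Xh h i 0 h0); rewrite mpolyC0.
have uM : u \notin M by apply/negP => /(UI _ ku)/eqP; rewrite (negPf u0).
have [w ew] := pi_inv uM.
have [p pmon /eqP proot] := intA w.
have [t et] : exists t, pi u * phi t = 1.
  have eu : pi u = phi u%:P by rewrite phiC ku.
  by rewrite eu in ew *; apply: (inverse_of_integral ew pmon).
(* Clearing denominators: a power of h brings [phi t] into the image of K[x_U]. *)
have [N [v [kv ev]]] : exists N v, k U v = v /\ pi h ^+ N * phi t = pi v.
  elim/poly_ind: t {et} => [|t c [N [v [kv ev]]]].
    by exists 0%N, 0; rewrite !rmorph0 mulr0.
  exists N.+1, (v + h ^+ N.+1 * k U c); split.
    by rewrite rmorphD rmorphM rmorphXn kv kh kD.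
  rewrite [in LHS]rmorphD [phi (t * _)]rmorphM phiX phiC rmorphD rmorphM rmorphXn -ev.
  rewrite mulrDr; congr (_ + _).
  by rewrite exprS -[RHS]mul1r -ehi /y; ring.
apply: (@not_dvd_exp h v i N h0); rewrite -/u.
apply/eqP; rewrite -subr_eq0; apply/eqP; apply: UI.
  by rewrite rmorphB rmorphXn rmorphM kh ku kv.
by rewrite -quot_map_eq0 rmorphB rmorphXn rmorphM -/pi -ev mulrCA et mulr1 subrr.
Qed.

End Zariski.

(** * Regular sequences of symmetric functions *)

Section NonZeroDivisors.
Variable R : comNzRingType.
Implicit Types (J : R -> Prop) (x y : R).

Lemma nzdM J x y : nzd J x -> nzd J y -> nzd J (x * y).
Proof. by move=> hx hy z; rewrite -mulrA => /hx/hy. Qed.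

Lemma nzd_prod J (I : eqType) (r : seq I) (F : I -> R) :
  (forall i, i \in r -> nzd J (F i)) -> nzd J (\prod_(i <- r) F i).
Proof.
elim: r => [_|i r IH h]; first by move=> y; rewrite big_nil mul1r.
rewrite big_cons; apply: nzdM; first by apply: h; rewrite mem_head.
by apply: IH => j jr; apply: h; rewrite inE jr orbT.
Qed.

Lemma nzd_congr J x y : is_ideal J -> J (x - y) -> nzd J x -> nzd J y.
Proof.
move=> iJ Jxy hx z Jyz; apply: hx.
by rewrite -(subrK (y * z) (x * z)) -mulrBl; apply: idealD => //; apply: ideal_mulr.
Qed.

Lemma adjoin_congr J x y : is_ideal J -> J (x - y) -> adjoin J x = adjoin J y.
Proof.
move=> iJ Jxy; have Jyx : J (y - x) by rewrite -opprB; apply: idealN.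
apply: eq_ideal => z; split; apply: adjoin_min; try exact: adjoin_ideal;
  try exact: sub_adjoin; by exists 1; rewrite mul1r.
Qed.

Lemma colon_adjoin_mul J x y : nzd J x -> is_ideal J ->
  colon (adjoin J (x * y)) x = adjoin J y.
Proof.
move=> hx iJ; apply: eq_ideal => z; rewrite /colon; split=> -[t Jt]; exists t.
  by apply: hx; rewrite (_ : x * _ = z * x - t * (x * y)) //; ring.
by rewrite (_ : _ - _ = (z - t * y) * x); [apply: ideal_mulr|ring].
Qed.

(** Descending induction on k: with e the degree of p, the coefficient of p q at e + k is q_k plus
    multiples of coefficients of q of index above k. *)
Lemma monic_coef_ideal J (p q : {poly R}) : is_ideal J -> p \is monic ->
  (forall k, J (p * q)`_k) -> forall k, J q`_k.
Proof.
move=> iJ mon hpq.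
suff h m k : (size q <= k + m)%N -> J q`_k by move=> k; apply: (h (size q)); apply: leq_addl.
elim: m k => [|m IH] k.
  by rewrite addn0 => sk; rewrite nth_default //; apply: ideal0.
move=> sk; set e := (size p).-1.
have sp : size p = e.+1 by rewrite prednK // size_poly_gt0 monic_neq0.
have pe : p`_e = 1 by rewrite -lead_coefE (monicP mon).
have := hpq (e + k)%N; rewrite coefM.
have lt_e : (e < (e + k).+1)%N by rewrite ltnS leq_addr.
rewrite (bigD1 (Ordinal lt_e)) //= addKn pe mul1r.
set t := (X in J (_ + X)) => h; rewrite -(addrK t q`_k); apply: (idealB iJ h).
apply: ideal_sum => // j ne; have [je|ej] := ltnP j e.
  apply: (idealM iJ); apply: IH.
  rewrite -(addnBAC k (ltnW je)); apply: leq_trans sk _.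
  by rewrite addnS -addSn leq_add2r -[X in (X < _)%N]add0n ltn_add2r subn_gt0.
rewrite nth_default ?mul0r; first exact: ideal0.
by rewrite sp ltn_neqAle ej andbT eq_sym.
Qed.

End NonZeroDivisors.

Section RegularSequence.
Variables (K : fieldType) (n : nat).
Implicit Types (D A : {set 'I_n}) (f g : 'I_n -> {poly K}).

(** General [f] is allowed because killing factors of a symmetric function adds generators g_i(x_i)
    to the initial x_i. *)
Definition sep_ideal D f := span [seq evX K i (f i) | i <- enum D].

Lemma sep_ideal_is_ideal D f : is_ideal (sep_ideal D f).
Proof. exact: span_ideal. Qed.

Lemma mem_sep_ideal D f i : i \in D -> sep_ideal D f (evX K i (f i)).
Proof. by move=> iD; apply: mem_span; apply: map_f; rewrite mem_enum. Qed.

Lemma sep_ideal_min D f (J : {mpoly K[n]} -> Prop) : is_ideal J ->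
  (forall i, i \in D -> J (evX K i (f i))) -> subideal (sep_ideal D f) J.
Proof.
by move=> iJ h; apply: span_min => // x /mapP[i]; rewrite mem_enum => /h ? ->.
Qed.

Lemma as_poly_evX i j (p : {poly K}) :
  as_poly K i (evX K j p) = if j == i then map_poly (@mpolyC n K) p else (evX K j p)%:P.
Proof.
elim/poly_ind: p => [|p c IH].
  by rewrite !rmorph0; case: ifP.
rewrite rmorphD rmorphM evX_X evXC rmorphD rmorphM as_polyC as_polyX IH.
case: eqP => _; last by rewrite polyCD polyCM.
by rewrite [RHS]rmorphD [in RHS]rmorphM /= map_polyX map_polyC.
Qed.

(** The generators do not involve x_i, so membership can be tested on coefficients in x_i. *)
Lemma sep_ideal_coef D f i p : i \notin D ->
  sep_ideal D f p <-> forall k, sep_ideal D f (as_poly K i p)`_k.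
Proof.
move=> iD; have iJ := sep_ideal_is_ideal D f; split; last first.
  move=> h; rewrite -(as_polyK i p) horner_coef.
  by apply: (ideal_sum _ iJ) => k _; apply: (ideal_mulr _ iJ).
pose C p := forall k, sep_ideal D f (as_poly K i p)`_k; rewrite -/(C p).
move: p; apply: sep_ideal_min => [|j jD k].
  split.
  - by move=> k; rewrite rmorph0 coef0; apply: (ideal0 iJ).
  - by move=> x y hx hy k; rewrite rmorphD coefD; exact: (idealD iJ (hx k) (hy k)).
  - move=> r x hx k; rewrite rmorphM coefM; apply: (ideal_sum _ iJ) => j _.
    exact: (idealM iJ _ (hx _)).
rewrite as_poly_evX (negPf (memPn iD j jD)) coefC.
by case: ifP => _; [apply: mem_sep_ideal|apply: (ideal0 iJ)].
Qed.

Lemma evX_nzd D f i (p : {poly K}) : i \notin D -> p \is monic ->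
  nzd (sep_ideal D f) (evX K i p).
Proof.
move=> iD mon y /(sep_ideal_coef _ _ iD) h; apply/(sep_ideal_coef _ _ iD).
apply: (monic_coef_ideal (sep_ideal_is_ideal D f) (monic_map (@mpolyC n K) mon)).
by move=> k; have := h k; rewrite rmorphM as_poly_evX eqxx.
Qed.

Variable g : 'I_n -> {poly K}.
Hypothesis g_monic : forall i, g i \is monic.
Let z i := evX K i (g i).

Definition sym_poly k := \sum_(h : {set 'I_n} | #|h| == k) \prod_(i in h) z i.

Fixpoint sym_seq k := if k is k'.+1 then sym_poly k :: sym_seq k' else [::].

Lemma sep_ideal_z D f i : (exists q, g i = q * f i) -> i \in D -> sep_ideal D f (z i).
Proof.
move=> [q eq] iD; rewrite /z eq rmorphM; apply: (idealM (sep_ideal_is_ideal D f)).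
exact: mem_sep_ideal.
Qed.

(** A set of k indices other than the complement of [D] meets [D], so its product lies in the
    ideal. *)
Lemma sym_poly_mod D f k : (forall i, exists q, g i = q * f i) -> (#|D| + k = n)%N ->
  sep_ideal D f (sym_poly k - \prod_(i in ~: D) z i).
Proof.
move=> fg Dk; have iJ := sep_ideal_is_ideal D f.
have cD : #|~: D| = k.
  by apply/eqP; rewrite -(eqn_add2l #|D|) cardsC card_ord Dk.
rewrite /sym_poly (bigD1 (~: D)) ?cD //= addrAC subrr add0r.
apply: (ideal_sum _ iJ) => h /andP[/eqP hk ne].
have [i ih iD] : exists2 i, i \in h & i \in D.
  apply: contrapT => no; case/negP: ne; rewrite eqEcard cD hk leqnn andbT.
  apply/subsetP => i ih; rewrite inE; apply/negP => iD; apply: no.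
  by exists i.
by rewrite (bigD1 i) //=; apply: (ideal_mulr _ iJ); apply: sep_ideal_z.
Qed.

(* Modulo [sep_ideal D f], [sym_poly k] is the product of the [z i] outside
   [D], and killing one of its factors decreases [k]. *)
Lemma wreg_sym_seq k D f : (#|D| + k = n)%N -> (forall i, f i \is monic) ->
  (forall i, exists q, g i = q * f i) -> wreg (sep_ideal D f) (sym_seq k).
Proof.
elim: k D f => //= k IH D f Dk mf fg.
have iJ := sep_ideal_is_ideal D f.
have hz := sym_poly_mod fg Dk.
have enumE : \prod_(i in ~: D) z i = \prod_(i <- enum (~: D)) z i by rewrite big_enum.
have zz i : i \notin D -> nzd (sep_ideal D f) (z i) by move=> iD; apply: evX_nzd.
split.
  apply: (nzd_congr (x := \prod_(i in ~: D) z i)) => //.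
    by rewrite -opprB; apply: (idealN iJ).
  by rewrite enumE; apply: nzd_prod => i; rewrite mem_enum inE; apply: zz.
rewrite (adjoin_congr iJ hz) enumE.
have: forall i, i \in enum (~: D) -> i \notin D by move=> i; rewrite mem_enum inE.
(* Induction on the factors: the colon by z_i removes z_i from the product, and adjoining z_i leads
   to the outer induction with i added to [D]. The empty product gives the unit ideal. *)
elim: (enum _) => [_|i r IHr h].
  rewrite big_nil; apply: wreg_unit; first exact: adjoin_ideal.
  exact: mem_adjoin.
have iD := h i (mem_head _ _); rewrite big_cons.
apply: (wreg_ext (f := z i)); first exact: adjoin_ideal.
  rewrite colon_adjoin_mul //; last exact: zz.
  by apply: IHr => j jr; apply: h; rewrite inE jr orbT.
pose f' j := if j == i then g i else f j.
have -> : adjoin (adjoin (sep_ideal D f) (z i * \prod_(j <- r) z j)) (z i)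
          = sep_ideal (i |: D) f'.
  have iJ' := sep_ideal_is_ideal (i |: D) f'.
  have zi' : sep_ideal (i |: D) f' (z i).
    have -> : z i = evX K i (f' i) by rewrite /f' eqxx.
    by apply: mem_sep_ideal; rewrite setU11.
  apply: eq_ideal => y; split.
    apply: adjoin_min => //; apply: adjoin_min => //; last exact: (ideal_mulr _ iJ').
    apply: sep_ideal_min => // j jD.
    have -> : f j = f' j by rewrite /f'; case: eqP jD => // ->; rewrite (negPf iD).
    by apply: mem_sep_ideal; rewrite !inE jD orbT.
  have iA := adjoin_ideal (z i * \prod_(j <- r) z j) iJ.
  apply: sep_ideal_min => [|j]; first exact: adjoin_ideal.
  rewrite !inE => /predU1P[->|jD]; first by rewrite /f' eqxx; apply: mem_adjoin.
  rewrite /f'; case: eqP => [->|_]; first exact: mem_adjoin.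
  by apply: sub_adjoin => //; apply: sub_adjoin => //; apply: mem_sep_ideal.
apply: IH => [|j|j].
- by rewrite cardsU1 iD add1n addSn -addnS.
- by rewrite /f'; case: ifP.
- by rewrite /f'; case: eqP => [->|_]; [exists 1; rewrite mul1r|].
Qed.

End RegularSequence.

(** * Monomial ideals *)

Section MonomialIdeals.
Variables (K : fieldType) (n : nat).
Implicit Types (U : pred 'X_{1..n}) (D A B : {set 'I_n}) (a : 'I_n -> nat).
Implicit Types (p q : {mpoly K[n]}) (m v : 'X_{1..n}).

Definition up_closed U := forall m m', U m -> U (m + m')%MM.

Definition mon_ideal U : {mpoly K[n]} -> Prop :=
  fun p => forall m, m \in msupp p -> U m.

Lemma mon_ideal_is_ideal U : up_closed U -> is_ideal (mon_ideal U).
Proof.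
move=> upU; split=> [m|p q hp hq m|r p hp m].
- by rewrite msupp0.
- by move/msuppD_le; rewrite mem_cat => /orP[/hp|/hq].
- move/msuppM_le/allpairsP => [[m1 m2] /= [_ /hp Um2 ->]].
  by rewrite addmC; apply: upU.
Qed.

Lemma mon_ideal_X U m : mon_ideal U 'X_[m] <-> U m.
Proof.
split=> [h|Um k]; first by apply: h; rewrite msuppX mem_head.
by rewrite msuppX inE => /eqP ->.
Qed.

Lemma mon_ideal_min U (J : {mpoly K[n]} -> Prop) : is_ideal J ->
  (forall m, U m -> J 'X_[m]) -> subideal (mon_ideal U) J.
Proof.
move=> iJ h p Up; rewrite [p]mpolyE big_seq.
apply: (ideal_sum _ iJ) => m mp; rewrite -mul_mpolyC.
by apply: (idealM iJ); apply: h; apply: Up.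
Qed.

Lemma eq_mon_ideal U U' : U =1 U' -> mon_ideal U = mon_ideal U'.
Proof. by move=> e; apply: eq_ideal => p; split=> h m /h; rewrite e. Qed.

Lemma colon_mon_ideal U v :
  colon (mon_ideal U) 'X_[v] = mon_ideal (fun m => U (m + v)%MM).
Proof.
apply: eq_ideal => p; split=> h m.
  by move=> mp; apply: h; rewrite (perm_mem (msuppMX p v)) addmC map_f.
by rewrite (perm_mem (msuppMX p v)) => /mapP[m' /h Um' ->]; rewrite addmC.
Qed.

Lemma adjoin_mon_ideal U i : up_closed U ->
  adjoin (mon_ideal U) 'X_i = mon_ideal (fun m => U m || (0 < m i)%N).
Proof.
move=> upU; have iU := mon_ideal_is_ideal upU.
have upU' : up_closed (fun m => U m || (0 < m i)%N).
  move=> m m' /orP[/(upU _ m') ->//|mi].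
  by rewrite mnmDE ltn_addr ?orbT.
have iA := adjoin_ideal 'X_i iU; have iU' := mon_ideal_is_ideal upU'.
apply: eq_ideal => p; split.
  apply: (adjoin_min iU') => [q h m /h ->//|].
  by apply/mon_ideal_X; rewrite mnm1E eqxx orbT.
apply: (mon_ideal_min iA) => m /orP[Um|mi].
  by apply: (sub_adjoin _ iU); apply/mon_ideal_X.
have e : (m - U_(i) + U_(i))%MM = m by apply: submK; rewrite lep1mP -lt0n.
by rewrite -e mpolyXD; apply: (idealM iA); exact: (mem_adjoin _ iU).
Qed.

(** The prime P_A, as a [sep_ideal] so that [wreg_sym_seq] applies to it directly. *)
Definition var_ideal A := sep_ideal A (fun _ => 'X : {poly K}).
Definition meets A m := [exists i in A, (0 < m i)%N].

Lemma meets_up A : up_closed (meets A).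
Proof.
move=> m m' /exists_inP[i iA mi]; apply/exists_inP; exists i => //.
by rewrite mnmDE ltn_addr.
Qed.

Lemma var_ideal_is_ideal A : is_ideal (var_ideal A).
Proof. exact: sep_ideal_is_ideal. Qed.

Lemma var_ideal_min A (J : {mpoly K[n]} -> Prop) : is_ideal J ->
  (forall i, i \in A -> J 'X_i) -> subideal (var_ideal A) J.
Proof. by move=> iJ h; apply: (sep_ideal_min iJ) => i /h; rewrite evX_X. Qed.

Lemma mem_var_ideal A i : i \in A -> var_ideal A 'X_i.
Proof. by move=> iA; rewrite -(evX_X K i); apply: (mem_sep_ideal (fun _ => 'X)). Qed.

Lemma var_idealE A : var_ideal A = mon_ideal (meets A).
Proof.
have iM := mon_ideal_is_ideal (@meets_up A); have iV := var_ideal_is_ideal A.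
apply: eq_ideal => p; split.
  apply: (var_ideal_min iM) => i iA; apply/mon_ideal_X.
  by apply/exists_inP; exists i; rewrite ?mnm1E ?eqxx.
apply: (mon_ideal_min iV) => m /exists_inP[i iA mi].
have e : (m - U_(i) + U_(i))%MM = m by apply: submK; rewrite lep1mP -lt0n.
by rewrite -e mpolyXD; apply: (idealM iV); exact: mem_var_ideal.
Qed.

Lemma var_ideal_kill A p : var_ideal A p <-> kill K A p = 0.
Proof.
split.
  pose J q := kill K A q = 0; rewrite -/(J p); move: p; apply: var_ideal_min.
    split; rewrite /J; first exact: rmorph0.
      by move=> x y; rewrite rmorphD => -> ->; rewrite addr0.
    by move=> r x; rewrite rmorphM => ->; rewrite mulr0.
  by move=> i iA; rewrite /J killX iA.
move=> k0; rewrite -[p]subr0 -k0.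
by apply: (kill_mod _ (var_ideal_is_ideal A)) => i; apply: mem_var_ideal.
Qed.

Lemma var_ideal_prime A : is_prime (var_ideal A).
Proof.
split; first exact: var_ideal_is_ideal.
  by move/var_ideal_kill; rewrite rmorph1 => /eqP; rewrite oner_eq0.
move=> x y /var_ideal_kill; rewrite rmorphM => /eqP; rewrite mulf_eq0.
by case/orP=> /eqP h; [left|right]; apply/var_ideal_kill.
Qed.

Lemma var_ideal_X A i : var_ideal A 'X_i <-> i \in A.
Proof.
split; last exact: mem_var_ideal.
move/var_ideal_kill; rewrite killX; case: ifP => // _ /eqP.
by rewrite -msupp_eq0 msuppX.
Qed.

Lemma var_ideal_sub A B : subideal (var_ideal A) (var_ideal B) <-> A \subset B.
Proof.
split=> [h|/subsetP AB].
  by apply/subsetP => i iA; apply/var_ideal_X/h/var_ideal_X.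
apply: (var_ideal_min (var_ideal_is_ideal B)) => i /AB.
exact: mem_var_ideal.
Qed.

Lemma prime_mnm (Q : {mpoly K[n]} -> Prop) m : is_prime Q -> Q 'X_[m] ->
  exists2 i, (0 < m i)%N & Q 'X_i.
Proof.
move=> pQ; apply: contraPP => h; rewrite mpolyXE_id.
apply: (big_ind (fun p => ~ Q p)) => [|x y nx ny|i _].
- exact: (prime1 pQ).
- by case/(primeM pQ).
- have : forall k, (k <= m i)%N -> ~ Q ('X_i ^+ k).
    elim=> [_|k IH km]; first by rewrite expr0; exact: (prime1 pQ).
    rewrite exprS => /(primeM pQ)[Qi|]; last exact/IH/ltnW.
    by apply: h; exists i => //; apply: leq_trans km.
  by apply.
Qed.

Lemma exists_mnm_le (b : 'I_n -> nat) d : (d <= \sum_i b i)%N ->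
  exists2 u : 'X_{1..n}, mdeg u = d & forall i, (u i <= b i)%N.
Proof.
elim: d => [_|d IH db]; first by exists 0%MM => [|i]; rewrite ?mdeg0 ?mnm0E.
have [u du ub] := IH (ltnW db).
have [i ui] : exists i, (u i < b i)%N.
  apply: contrapT => h; suff : (\sum_i b i <= \sum_i u i)%N by rewrite -mdegE du leqNgt db.
  by apply: leq_sum => i _; rewrite leqNgt; apply/negP => lt; apply: h; exists i.
exists (u + U_(i))%MM; first by rewrite mdegD mdeg1 du addn1.
move=> j; rewrite mnmDE mnm1E; case: eqP => [<-|_]; first by rewrite addn1.
by rewrite addn0.
Qed.

(* The monomials of (x_i : i in D) + I_{d; a}. *)
Definition ver_mon D d a m := meets D m || (d <= \sum_i minn (m i) (a i))%N.

Lemma ver_mon_up D d a : up_closed (ver_mon D d a).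
Proof.
move=> m m' /orP[/(meets_up m') h|h]; first by rewrite /ver_mon h.
apply/orP; right; apply: leq_trans h _.
by apply: leq_sum => i _; rewrite mnmDE leq_min geq_minr geq_min leq_addr.
Qed.

(** A monomial x^m is a multiple of a generator iff the entrywise minimum of m and a has degree at
    least d: any exponent of degree d below this minimum gives the generator. *)
Lemma veronese_mon_ideal d a :
  (fun p => p \in veronese (K := K) d a : Prop) = mon_ideal (ver_mon set0 d a).
Proof.
have iM := mon_ideal_is_ideal (@ver_mon_up set0 d a).
apply: eq_ideal => p; rewrite ideal_genP; split.
  move=> h; apply: (h _ iM) => _ [u [du ua ->]]; apply/mon_ideal_X.
  apply/orP; right; rewrite -du mdegE; apply: leq_sum => i _.
  by rewrite leq_min leqnn ua.
move=> Mp J iJ h; move: p Mp; apply: (mon_ideal_min iJ) => m /orP[/exists_inP[i]|].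
  by rewrite inE.
move/exists_mnm_le => [u du ule].
have um : (u <= m)%MM by apply/mnm_lepP => i; apply: leq_trans (ule i) (geq_minl _ _).
rewrite -(submK um) mpolyXD; apply: (idealM iJ); apply: h; exists u; split=> // i.
exact: leq_trans (ule i) (geq_minr _ _).
Qed.

(** * Weights of sets of variables *)

Definition asum a A := (\sum_(i in A) a i)%N.
(* Truncated: [mu d a] is 0 when the sum of the [a i] is less than [d]. *)
Definition mu d a := ((\sum_i a i).+1 - d)%N.

Definition good d a A :=
  [&& [forall i in A, (0 < a i)%N], (#|A| <= mu d a)%N & (mu d a <= asum a A)%N].

Lemma asumC a A : (\sum_i a i = asum a A + asum a (~: A))%N.
Proof.
rewrite /asum (bigID (mem A)) /=; congr (_ + _)%N.
by apply: eq_bigl => i; rewrite inE.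
Qed.

Lemma asumU1 a A i : i \notin A -> asum a (i |: A) = (a i + asum a A)%N.
Proof. by move=> iA; rewrite /asum big_setU1. Qed.

Lemma sum_modify a i x : (\sum_j (if j == i then x else a j) + a i = \sum_j a j + x)%N.
Proof.
rewrite (bigD1 i) //= eqxx [in RHS](bigD1 i) //=.
rewrite (eq_bigr a) => [|j /negPf -> //].
by rewrite -addnA addnC [X in (X + _)%N]addnC.
Qed.

(** Induction on the sum of the a_i. For the colon by x_i, both d and a_i drop by 1 and mu is
    unchanged. When x_i is adjoined, i moves into [D], a_i becomes 0 and mu drops by a_i, so a good
    A for the new data gives the good set i |: A for the old. *)
Lemma wreg_ver_mon c (s : seq {mpoly K[n]}) :
  (forall A, #|A| = c -> wreg (var_ideal A) s) ->
  forall D d a, (forall i, i \in D -> a i = 0%N) ->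
  (forall A, good d a A -> (#|D| + #|A| = c)%N) ->
  wreg (mon_ideal (ver_mon D d a)) s.
Proof.
move=> hs D d a; have [N] := ubnP (\sum_i a i).
elim: N D d a => // N IH D d a; rewrite ltnS => aN aD hc.
have iM := mon_ideal_is_ideal (@ver_mon_up D d a).
case: (posnP d) => [d0|d_gt0].
  apply: (wreg_unit _ iM); move=> m _.
  by rewrite /ver_mon d0 leq0n orbT.
(* If the a_i sum to less than d, the Veronese part is zero and the ideal is P_D; mu is 0, and the
   good empty set yields #|D| = c. *)
have [lt_ad|le_da] := ltnP (\sum_i a i) d.
  have mu0 : mu d a = 0%N by apply/eqP; rewrite subn_eq0.
  have -> : mon_ideal (ver_mon D d a) = var_ideal D.
    rewrite var_idealE; apply: eq_mon_ideal => m; rewrite /ver_mon orbC.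
    rewrite leqNgt (leq_ltn_trans _ lt_ad) //; apply: leq_sum => i _.
    exact: geq_minr.
  apply: hs; have := hc set0; rewrite cards0 addn0; apply.
  by rewrite /good cards0 mu0 !leq0n !andbT; apply/forall_inP => i; rewrite inE.
have [i ai] : exists i, (0 < a i)%N.
  apply: contrapT => h; have : (0 < \sum_i a i)%N by apply: leq_trans le_da.
  rewrite big1 // => i _; apply/eqP; rewrite -leqn0 leqNgt; apply/negP => lt.
  by apply: h; exists i.
have iD : i \notin D by apply/negP => /aD ai0; rewrite ai0 in ai.
apply: (wreg_ext (f := 'X_i) iM).
  pose a' j := if j == i then (a i).-1 else a j.
  have sa : ((\sum_j a' j).+1 = \sum_j a j)%N.
    have := sum_modify a i (a i).-1.
    by rewrite -[X in (_ + X)%N = _](prednK ai) addnS -addSn => /addIn.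
  have -> : colon (mon_ideal (ver_mon D d a)) 'X_i = mon_ideal (ver_mon D d.-1 a').
    rewrite colon_mon_ideal; apply: eq_mon_ideal => m; rewrite /ver_mon; congr (_ || _).
      apply: eq_existsb => j; case: (boolP (j \in D)) => //= jD.
      rewrite mnmDE mnm1E; case: eqP => [e|_]; first by rewrite e jD in iD.
      by rewrite addn0.
    have -> : (\sum_j minn ((m + U_(i))%MM j) (a j) = (\sum_j minn (m j) (a' j)).+1)%N.
      rewrite (bigD1 i) //= [in RHS](bigD1 i) //= mnmDE mnm1E eqxx addn1 /a' eqxx.
      rewrite -{1}(prednK ai) minnSS addSn; congr (_ + _).+1.
      apply: eq_bigr => j ji; rewrite mnmDE mnm1E eq_sym (negPf ji) addn0.
      by [].
    by rewrite -{1}(prednK d_gt0) ltnS.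
  have mu' : mu d.-1 a' = mu d a.
    by rewrite /mu sa -{2}(prednK d_gt0) subSS.
  apply: IH => [|j jD|A /and3P[/forall_inP Aa]].
  - by rewrite -ltnS ltnS (leq_trans _ aN) // -sa.
  - by rewrite /a'; case: eqP jD => [->|_ /aD //]; rewrite (negPf iD).
  rewrite mu' => muA Amu; apply: hc; apply/and3P; split=> //.
    apply/forall_inP => j /Aa; rewrite /a'; case: eqP => [->|//] _; exact: ai.
  apply: leq_trans Amu _; apply: leq_sum => j _; rewrite /a'; case: eqP => [->|//].
  exact: leq_pred.
pose a' j := if j == i then 0%N else a j.
have sa : (\sum_j a' j + a i = \sum_j a j)%N by rewrite sum_modify addn0.
have -> : adjoin (mon_ideal (ver_mon D d a)) 'X_i = mon_ideal (ver_mon (i |: D) d a').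
  rewrite (adjoin_mon_ideal _ (@ver_mon_up D d a)); apply: eq_mon_ideal => m; rewrite /ver_mon.
  have -> : meets (i |: D) m = meets D m || (0 < m i)%N.
    apply/exists_inP/orP => [[j]|[/exists_inP[j jD mj]|mi]].
    - rewrite !inE => /predU1P[->|jD] mj; [by right|left].
      by apply/exists_inP; exists j.
    - by exists j => //; rewrite !inE jD orbT.
    - by exists i => //; rewrite setU11.
  rewrite -!orbA; congr (_ || _); rewrite orbC.
  case: posnP => //= mi; congr (_ <= _)%N; apply: eq_bigr => j _; rewrite /a'.
  by case: eqP => [->|//]; rewrite mi !min0n.
have mu' : mu d a' = (mu d a - a i)%N.
  by rewrite /mu -sa -addSn subnAC addnK.
apply: IH => [|j|A /and3P[/forall_inP Aa]].
- by apply: leq_trans aN; rewrite -sa -[X in (X < _)%N]addn0 ltn_add2l.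
- by rewrite !inE /a'; case: eqP => //= _ /aD.
rewrite mu' => muA Amu.
have iA : i \notin A by apply/negP => /Aa; rewrite /a' eqxx.
have eA : asum a' A = asum a A.
  apply: eq_bigr => j jA; rewrite /a'; case: eqP => // ji.
  by rewrite ji (negPf iA) in jA.
rewrite cardsU1 iD -(hc (i |: A)) ?cardsU1 ?iA ?[in RHS]addnA ?[in RHS](addnC #|D|) //.
(* Positivity of mu leaves room for i: #|A| <= mu - a_i < mu. *)
have mu_gt0 : (0 < mu d a)%N by rewrite subn_gt0 ltnS.
apply/and3P; split.
- apply/forall_inP => j; rewrite !inE => /predU1P[->//|/Aa].
  by rewrite /a'; case: eqP => [->|//].
- rewrite cardsU1 iA add1n; apply: (@leq_ltn_trans (mu d a - a i)) => //.
  by rewrite -[X in (_ < X)%N]subn0 ltn_sub2l.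
- by rewrite asumU1 // -leq_subLR -eA.
Qed.

(** The origin of mu: with A the set of variables in Q, the monomial with exponent a outside A and 0
    on A is not in Q, and it lies in the ideal exactly when the weight outside A is at least d, that
    is when A has weight below mu. *)
Lemma veronese_sub_prime d a (Q : {mpoly K[n]} -> Prop) :
  (d <= \sum_i a i)%N -> is_prime Q ->
  subideal (mon_ideal (ver_mon set0 d a)) Q <->
  (mu d a <= asum a [set i | `[< Q 'X_i >]])%N.
Proof.
move=> da pQ; set A := [set i | _]; split=> [sQ|muA].
  rewrite leqNgt; apply/negP => ltA.
  pose w := [multinom if i \in A then 0%N else a i | i < n].
  have : Q 'X_[w].
    apply/sQ/mon_ideal_X/orP; right.
    rewrite (_ : (\sum_i _ = asum a (~: A))%N).
      move: ltA; rewrite /mu (asumC a A) -addnS ltn_subRL addnC ltn_add2l ltnS.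
      by [].
    rewrite /asum [in RHS]big_mkcond; apply: eq_bigr => i _; rewrite inE mnmE.
    by case: (i \in A); rewrite ?min0n ?minnn.
  case/(prime_mnm pQ) => i; rewrite mnmE; case: ifP => // /negP iA _ Qi.
  by apply: iA; rewrite inE; apply/asboolP.
apply: (mon_ideal_min (prime_ideal pQ)) => m /orP[/exists_inP[i]|dm]; first by rewrite inE.
have [i /andP[iA mi]|h] := pickP (fun i => (i \in A) && (0 < m i)%N).
  have e : (m - U_(i) + U_(i))%MM = m by apply: submK; rewrite lep1mP -lt0n.
  rewrite -e mpolyXD; apply: (idealM (prime_ideal pQ)).
  by move: iA; rewrite inE => /asboolP.
exfalso; have : (d <= asum a (~: A))%N.
  apply: leq_trans dm _; rewrite /asum [X in (_ <= X)%N]big_mkcond; apply: leq_sum => i _.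
  rewrite inE; have := h i; case: (i \in A) => /=; last by rewrite geq_minr.
  by case: posnP => // ->; rewrite min0n.
move: muA; rewrite /mu (asumC a A) leq_subLR -addnS [X in (_ <= X)%N]addnC leq_add2l.
by move=> ltd /(leq_trans ltd); rewrite ltnn.
Qed.

(** The witness x^v has degree d - 1, with v = a outside A and v = u < a on A: one more variable
    from A brings it into the ideal, variables outside A never do. That mu is at most the weight of
    A makes the degree left for u non-negative, and #|A| <= mu lets u fit below a - 1 on A. *)
Lemma var_ideal_associated d a A : (0 < d)%N -> (d <= \sum_i a i)%N -> good d a A ->
  associated (mon_ideal (ver_mon set0 d a)) (var_ideal A).
Proof.
move=> d_gt0 da /and3P[/forall_inP Aa muA Amu]; split; first exact: var_ideal_prime.
have muE : (mu d a + d.-1 = \sum_i a i)%N.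
  by apply/eqP; rewrite -eqSS -addnS prednK // subnK // leqW.
have dA : (asum a (~: A) <= d.-1)%N.
  by rewrite -(leq_add2l (mu d a)) muE (asumC a A) leq_add2r.
pose b i := if i \in A then (a i).-1 else 0%N.
have sb : (\sum_i b i + #|A| = asum a A)%N.
  rewrite /b -big_mkcond -sum1_card -big_split; apply: eq_bigr => i iA /=.
  by rewrite addn1 prednK // Aa.
have [|u du ub] := @exists_mnm_le b (d.-1 - asum a (~: A)).
  rewrite leq_subLR -(leq_add2r #|A|) -addnA sb [X in (_ <= X)%N]addnC -asumC -muE addnC.
  by rewrite leq_add2r.
pose v := [multinom if i \in A then u i else a i | i < n].
exists 'X_[v]; rewrite var_idealE colon_mon_ideal; apply: eq_mon_ideal => m.
have u_off i : i \notin A -> u i = 0%N.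
  by move=> iA; apply/eqP; rewrite -leqn0; have := ub i; rewrite /b (negPf iA).
have su : (\sum_(i in A) u i = d.-1 - asum a (~: A))%N.
  rewrite -du mdegE [RHS](bigID (mem A)) /= [X in (_ + X)%N]big1 ?addn0 //.
have eS : (\sum_i minn ((m + v)%MM i) (a i)
           = \sum_(i in A) minn (m i + u i) (a i) + asum a (~: A))%N.
  rewrite (bigID (mem A)) /=; congr (_ + _)%N.
    by apply: eq_bigr => i iA; rewrite mnmDE mnmE iA.
  rewrite /asum; apply: eq_big => i; first by rewrite inE.
  by move=> iA; rewrite mnmDE mnmE (negPf iA); apply/minn_idPr/leq_addl.
have m0 : meets set0 (m + v)%MM = false by apply/exists_inP => -[i]; rewrite inE.
rewrite /ver_mon m0 /= eS.
have ua i : i \in A -> (u i < a i)%N.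
  by move=> iA; have := ub i; rewrite /b iA => /leq_ltn_trans; apply; rewrite prednK // Aa.
apply/exists_inP/idP => [[i iA mi]|].
  rewrite addnC -leq_subLR [(_ - _)%N](_ : _ = (\sum_(i in A) u i).+1); last first.
    by rewrite su -subSn // prednK.
  rewrite (bigD1 i) //= [X in (_ <= X)%N](bigD1 i) //= -addSn leq_add //.
    by rewrite leq_min ua // -add1n leq_add2r mi.
  by apply: leq_sum => j /andP[jA _]; rewrite leq_min leq_addl ltnW ?ua.
move=> h; apply: contrapT => nm; move: h; apply/negP; rewrite -ltnNge.
rewrite (eq_bigr u) => [|i iA].
  by rewrite su subnK // prednK.
have -> : m i = 0%N.
  by apply/eqP; rewrite -leqn0 leqNgt; apply/negP => mi; apply: nm; exists i.
by rewrite add0n; apply/minn_idPl/ltnW/ua.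
Qed.

(** Removing any i from a minimal A brings the weight below mu. Hence each a_i is positive, and #|A|
    - 1 is at most the weight of A without i, which is below mu. *)
Lemma good_of_minset d a A : minset (fun B => mu d a <= asum a B)%N A -> good d a A.
Proof.
move=> /minsetP[Amu Amin].
have rem i : i \in A -> (asum a (A :\ i) < mu d a)%N.
  move=> iA; rewrite ltnNge; apply/negP => le; have := Amin _ le (subD1set _ _).
  by move/setP/(_ i); rewrite !inE eqxx iA.
have dec i : i \in A -> asum a A = (a i + asum a (A :\ i))%N.
  by move=> iA; rewrite -asumU1 ?setD1K // !inE eqxx.
have Apos i : i \in A -> (0 < a i)%N.
  move=> iA; have := leq_ltn_trans (leqnn _) (rem i iA).
  rewrite lt0n => lt; apply/eqP => ai0.
  by move: Amu; rewrite (dec i iA) ai0 add0n leqNgt lt.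
apply/and3P; split=> //; first exact/forall_inP.
have [->|/set0Pn[i iA]] := eqVneq A set0; first by rewrite cards0.
rewrite (cardsD1 i) iA add1n; apply: leq_ltn_trans (rem i iA).
rewrite -sum1_card; apply: leq_sum => j; rewrite !inE => /andP[_]; exact: Apos.
Qed.

End MonomialIdeals.

(** * Ideals of Veronese type *)

Section VeroneseType.
Variables (K : fieldType) (n d : nat) (a : 'I_n -> nat).
Hypotheses (d_gt0 : (0 < d)%N) (d_le_a : (d <= \sum_(i < n) a i)%N).
Implicit Types (A B : {set 'I_n}).

Local Notation S := {mpoly K[n]}.
Let I : idealr S := veronese_ideal K a d_gt0.
Let IP (p : S) : Prop := p \in I.

Lemma veronese_idealE : IP = mon_ideal (ver_mon set0 d a).
Proof. exact: veronese_mon_ideal. Qed.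

Lemma var_ideal_contains A : (mu d a <= asum a A)%N -> subideal IP (@var_ideal K n A).
Proof.
move=> muA; rewrite veronese_idealE; apply/(veronese_sub_prime d_le_a (var_ideal_prime K A)).
rewrite (_ : [set i | _] = A) //; apply/setP => i; rewrite inE.
by apply/asboolP/idP => /var_ideal_X.
Qed.

Lemma good_associated A (P : prime_idealr S) : good d a A ->
  (forall p, p \in P <-> @var_ideal K n A p) -> associated_prime I P.
Proof.
move=> gA eP; apply/associated_primeP; rewrite (eq_ideal eP) -/IP veronese_idealE.
exact: var_ideal_associated.
Qed.

(** The variables in P have weight at least mu; a minimal subset of this weight gives a prime P_A
    between the ideal and P. *)
Lemma minimal_prime_good (P : prime_idealr S) : minimal_prime I P ->
  exists2 A, good d a A & forall p, p \in P <-> @var_ideal K n A p.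
Proof.
move=> [sIP minP]; have pP := prime_idealr_is_prime P.
have: subideal IP (fun p => p \in P) by exact: sIP.
rewrite veronese_idealE => /(veronese_sub_prime d_le_a pP).
set A0 := [set i | _] => muA0.
have [A mA sA] := minset_exists (P := fun B => (mu d a <= asum a B)%N) muA0.
exists A; first exact: good_of_minset mA.
have [muA _] := minsetP mA.
have sAP : subideal (@var_ideal K n A) (fun p => p \in P).
  apply: (var_ideal_min (prime_ideal pP)) => i /(subsetP sA).
  by rewrite inE => /asboolP.
have [Q eQ] := exists_prime_idealr (var_ideal_prime K A).
move=> p; split; last exact: sAP.
move=> pP'; apply/eQ; apply: (minP Q) => // q.
  by move=> /(var_ideal_contains muA) h; apply/eQ.
by move=> /eQ/sAP.
Qed.

Lemma minimal_associated (P : prime_idealr S) : minimal_prime I P -> associated_prime I P.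
Proof. by case/minimal_prime_good => A gA; apply: good_associated. Qed.

Lemma cohen_macaulay_unmixed : cohen_macaulay_ideal I -> unmixed I.
Proof.
move=> cm P; split; last exact: minimal_associated.
exact: (cohen_macaulay_associated_minimal cm).
Qed.

(* If |A| < |B|, adding to A an element of B gives an associated prime which
   is not minimal. *)
Lemma unmixed_card : unmixed I -> exists c, forall A, good d a A -> #|A| = c.
Proof.
move=> um; have noLt A B : good d a A -> good d a B -> ~ (#|A| < #|B|)%N.
  move=> gA gB ltAB; have [Apos muA Amu] := and3P gA; have [Bpos muB _] := and3P gB.
  have [j jB jA] : exists2 j, j \in B & j \notin A.
    apply/subsetPn; apply: contraL ltAB => /subset_leq_card.
    by rewrite -leqNgt.
  have gjA : good d a (j |: A).
    apply/and3P; split.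
    - apply/forall_inP => i; rewrite !inE => /predU1P[->|iA].
        exact: (forall_inP Bpos).
      exact: (forall_inP Apos).
    - by rewrite cardsU1 jA add1n (leq_trans ltAB).
    - by rewrite asumU1 // (leq_trans Amu) // leq_addl.
  have [P eP] := exists_prime_idealr (var_ideal_prime K (j |: A)).
  have [Q eQ] := exists_prime_idealr (var_ideal_prime K A).
  have [_ minP] := (um P).1 (good_associated gjA eP).
  have sPQ : {subset P <= Q}.
    apply: (minP Q) => p.
      by move=> /(var_ideal_contains Amu) h; apply/eQ.
    by move=> /eQ h; apply/eP; exact: ((var_ideal_sub K A _).2 (subsetUr _ _) p h).
  move/negP: jA; apply; apply/(var_ideal_X K)/eQ/sPQ/eP/var_ideal_X.
  exact: setU11.
have [[A gA]|no] := pselect (exists A, good d a A); last first.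
  by exists 0%N => A gA; case: no; exists A.
exists #|A| => B gB; apply/eqP; rewrite eqn_leq.
by apply/andP; split; rewrite leqNgt; apply/negP; [exact: (noLt _ _ gA gB)|exact: (noLt _ _ gB gA)].
Qed.

(** The first prime of the chain contains the variables of some good set, and these number c. *)
Lemma chain_le_codim c l (C : nat -> S -> Prop) : (forall A, good d a A -> #|A| = c) ->
  chain l C -> subideal IP (C 0%N) -> (l <= n - c)%N.
Proof.
move=> hc hC; have pC : is_prime (C 0%N) by apply (proj1 hC).
rewrite veronese_idealE => /(veronese_sub_prime d_le_a pC).
set A0 := [set i | _] => muA0.
have [A mA sA] := minset_exists (P := fun B => (mu d a <= asum a B)%N) muA0.
rewrite -(hc A (good_of_minset mA)); apply: (chain_bound hC) => i /(subsetP sA).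
by rewrite inE => /asboolP.
Qed.

Lemma var_ideal_chain A : exists2 C : nat -> S -> Prop,
  chain (n - #|A|) C & C 0%N = @var_ideal K n A.
Proof.
pose T i := A :|: [set x in take i (enum (~: A))].
have sz : size (enum (~: A)) = (n - #|A|)%N.
  by rewrite -cardE cardsCs setCK card_ord.
exists (fun i => @var_ideal K n (T i)); last first.
  by congr (@var_ideal K n _); apply/setP => x; rewrite !inE take0 orbF.
split=> i il; first exact: var_ideal_prime.
have i0 : 'I_n := Ordinal (leq_ltn_trans (leq0n i) (leq_trans il (leq_subr _ _))).
have lt_i : (i < size (enum (~: A)))%N by rewrite sz.
split.
  apply/var_ideal_sub/subsetP => x; rewrite !inE => /orP[->//|].
  by rewrite (take_nth i0) // mem_rcons inE => ->; rewrite !orbT.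
set x := nth i0 (enum (~: A)) i.
have xA : x \notin A by have := mem_nth i0 lt_i; rewrite mem_enum inE.
move/var_ideal_sub/subsetP/(_ x); rewrite !inE (take_nth i0) // mem_rcons inE eqxx orbT.
move/(_ isT); rewrite (negPf xA) /= => /(nthP i0)[j].
rewrite size_take lt_i => ji; rewrite nth_take // => /eqP.
rewrite nth_uniq ?enum_uniq ?(ltn_trans ji) // => /eqP e.
by rewrite e ltnn in ji.
Qed.

Lemma card_equidimensional c : (forall A, good d a A -> #|A| = c) -> equidimensional I.
Proof.
move=> hc; exists (n - c)%N => P mP; have [A gA eP] := minimal_prime_good mP.
apply: quotient_krull_dim.
  have [C hC C0] := var_ideal_chain A; exists C; first by rewrite -(hc A gA).
  by rewrite C0 => p /eP.
move=> l C hC sC; apply: (chain_le_codim hc hC) => p Ip; apply: sC.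
by apply: (proj1 mP).
Qed.

Lemma card_cohen_macaulay c :
  (forall A, good d a A -> #|A| = c) -> cohen_macaulay_ideal I.
Proof.
move=> hc; apply: (@cohen_macaulay_ideal_intro _ I (@mpoly_noeth K n) (n - c)); last first.
  by move=> l C; apply: chain_le_codim.
move=> M pM Mmax sM; have iM := prime_ideal pM.
have [Q eQ] := exists_prime_idealr pM.
(* Maximality as invertibility modulo [Q], the form required by [zariski]. *)
have Qmax p : p \notin Q -> exists q, q * p - 1 \in Q.
  move=> pQ; have [[r Mr]|n1] := pselect (adjoin M p 1).
    by exists r; rewrite -opprB rpredN; apply/eQ.
  case/negP: pQ; apply/eQ.
  apply: (Mmax _ (adjoin_ideal p iM) n1 (sub_adjoin p iM)).
  exact: mem_adjoin.
have /choice[g gP] := zariski Qmax.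
have gmon i : g i \is monic by case: (gP i).
exists (sym_seq g (n - c)); split; last by elim: (n - c)%N => //= k ->.
  rewrite -/IP veronese_idealE; apply: (wreg_ver_mon (c := c)) => [A cA|i|A /hc ->].
  - apply: (wreg_sym_seq gmon) => [|i|i].
    + by rewrite cA subnKC // -cA -[X in (_ <= X)%N](card_ord n) max_card.
    + exact: monicX.
    + have [_ _ g0 _] := gP i; have /factor_theorem[q ->] : root (g i) 0.
        by rewrite /root horner_coef0 g0.
      by exists q; rewrite subr0.
  - by rewrite inE.
  - by rewrite cards0.
(* The sequence stops at e_1, so each product in it contains some z_i, which lies in M. *)
elim: (n - c)%N => //= k IH x; rewrite inE => /predU1P[->|/IH//].
apply: (ideal_sum _ iM) => h /eqP hk.
have /set0Pn[i ih] : h != set0 by rewrite -card_gt0 hk.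
rewrite (bigD1 i) //=; apply: (ideal_mulr _ iM); apply/eQ.
by case: (gP i).
Qed.

End VeroneseType.

Theorem theorem3p4 (K : fieldType) (n d : nat) (a : 'I_n -> nat)
    (d_gt0 : (0 < d)%N)
    (a_le_d : forall i : 'I_n, (a i <= d)%N)
    (d_le_sum_a : (d <= \sum_(i < n) a i)%N) :
  let I : idealr {mpoly K[n]} := veronese_ideal K a d_gt0 in
  (cohen_macaulay_ideal I <-> (unmixed I /\ equidimensional I)) /\
  ((unmixed I /\ equidimensional I) <-> unmixed I).
Proof.
move=> I; have cm_um : cohen_macaulay_ideal I -> unmixed I.
  exact: (cohen_macaulay_unmixed d_le_sum_a).
have um_eq : unmixed I -> equidimensional I.
  by move/(unmixed_card d_le_sum_a) => [c]; apply: card_equidimensional.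
split; [split=> [cm|[um _]]|split=> [[] //|um]].
- by have um := cm_um cm; split; [|apply: um_eq].
- by have [c] := unmixed_card d_le_sum_a um; apply: card_cohen_macaulay.
- by split; [|apply: um_eq].
Qed.
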